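(* Let $f:\mathbb{R}^d\to\mathbb{R}$ be twice differentiable with $m_2\cdot I\preceq\nabla^2 f(x)\preceq M_2\cdot I$ for all $x$, $0<m_2\le M_2$. Let $\epsilon>0$, $x^{(0)}\in\mathbb{R}^d$, and a step size $h\le\frac{m_2^{1/4}}{2M_2^{3/4}}$. Let $X$ be the output of the procedure $\mathrm{HMC}(x^{(0)},f,\epsilon,h)$ described below, and let $Y$ be distributed with density proportional to $e^{-f}$. Then $W_2(X,Y)\le\frac{\epsilon}{\sqrt{m_2}}$. Moreover the number of iterations of the procedure is \[ N=O\Big(\frac{1}{m_2h^2}\Big)\cdot\log\Big(\frac{\|\nabla f(x^{(0)})\|_2^2/m_2+d}{\epsilon}\Big). \]
   Context: Procedure $\mathrm{HMC}(x^{(0)},f,\epsilon,h)$: set $\theta=\frac{m_2h^2}{8}$, $N=\frac1\theta\log\big(\frac{4}{\epsilon^2}\big(\frac{\|\nabla f(x^{(0)})\|_2^2}{m_2}+d\big)\big)$ and $\bar\epsilon=\frac{\theta\epsilon}{2\sqrt{m_2}}$. For $k=1,\dots,N$: draw $v\sim\mathcal N(0,I_d)$ independently; let $x(t)$ solve $x''=-\nabla f(x)$, $x'(0)=v$, $x(0)=x^{(k-1)}$; choose any point $x^{(k)}$ with $\|x^{(k)}-x(h)\|_2\le\bar\epsilon$. Return $x^{(N)}$. The 2-Wasserstein distance is $W_2(\mu,\nu)=(\inf_{\text{couplings}}\mathbb{E}\|X-Y\|_2^2)^{1/2}$.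
   Formalization: With A = ‖∇f(x⁰)‖²/m₂ + d, the iteration bound is proved for A/ε ≥ K with any fixed K > 1 and a constant depending only on K, since no single constant works as A/ε → 1 (log → 0 but N > 0); N is rounded up to a natural number and h > 0 is assumed. *)

(* Defs.v *)
From HB Require Import structures.
From mathcomp Require Import all_boot all_order all_algebra.
From mathcomp Require Import all_classical all_reals all_analysis.
Set Implicit Arguments.
Unset Strict Implicit.
Unset Printing Implicit Defensive.
Import Order.TTheory GRing.Theory Num.Theory.
Import numFieldNormedType.Exports.
Local Open Scope classical_set_scope.
Local Open Scope ring_scope.

(* 'rV[R]_d carries the sup norm in the library; all metric notions below use *)
(* the Euclidean norm instead (the topology and the derivatives agree).       *)
Definition l2norm (R : realType) (d : nat) (u : 'rV[R]_d) : R :=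
  Num.sqrt (\sum_(i < d) u ord0 i ^+ 2).

Definition grad (R : realType) (d : nat) (f : 'rV[R]_d -> R) (x : 'rV[R]_d) :
  'rV[R]_d := \row_i 'D_(delta_mx ord0 i) f x.

Definition twice_differentiable (R : realType) (d : nat) (f : 'rV[R]_d -> R) :=
  (forall x, differentiable f x) /\ (forall x, differentiable (grad f) x).

Definition hessian (R : realType) (d : nat) (f : 'rV[R]_d -> R)
  (x : 'rV[R]_d) : 'M[R]_d := 'J (grad f) x.

Definition psdmx (R : realType) (d : nat) (A : 'M[R]_d) : Prop :=
  A^T = A /\ forall u : 'rV[R]_d, 0 <= (u *m A *m u^T) ord0 ord0.

Definition loewner_le (R : realType) (d : nat) (A B : 'M[R]_d) : Prop :=
  psdmx (B - A).

Definition well_conditioned (R : realType) (d : nat) (f : 'rV[R]_d -> R)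
    (m2 M2 : R) : Prop :=
  [/\ 0 < m2, m2 <= M2, twice_differentiable f &
      forall x, loewner_le m2%:M (hessian f x) /\
                loewner_le (hessian f x) M2%:M].

(* The sigma-algebra on R^d generated by the coordinates, i.e., the product   *)
(* (equivalently, Borel) one; same construction as the library's on n-tuples. *)
Definition measure_rV_display : measure_display.
Proof. exact: default_measure_display. Qed.

Section measurable_rV.
Context {R : realType} (d : nat).

Let coors : 'I_d -> 'rV[R]_d -> R := fun i x => x ord0 i.

Let rV_set0 : g_sigma_preimage coors set0.
Proof. exact: sigma_algebra0. Qed.

Let rV_setC A : g_sigma_preimage coors A -> g_sigma_preimage coors (~` A).
Proof. exact: sigma_algebraC. Qed.

Let rV_bigcup (F : _^nat) : (forall i, g_sigma_preimage coors (F i)) ->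
  g_sigma_preimage coors (\bigcup_i (F i)).
Proof. exact: sigma_algebra_bigcup. Qed.

HB.instance Definition _ := @isMeasurable.Build measure_rV_display
  'rV[R]_d (g_sigma_preimage coors) rV_set0 rV_setC rV_bigcup.

End measurable_rV.

Lemma measurable_coor (R : realType) (d : nat) (i : 'I_d) :
  measurable_fun [set: 'rV[R]_d] (fun x : 'rV[R]_d => x ord0 i).
Proof.
move=> _ Y mY; rewrite setTI; apply: sub_sigma_algebra => /=.
rewrite -bigcup_seq/=; exists i => /=; first by rewrite mem_index_enum.
by exists Y => //; rewrite setTI.
Qed.

Lemma measurable_fun_rVP (dT : measure_display) (T : measurableType dT)
    (R : realType) (d : nat) (f : T -> 'rV[R]_d) :
  (forall i, measurable_fun [set: T] (fun t => f t ord0 i)) ->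
  measurable_fun [set: T] f.
Proof.
move=> mf.
have H : g_sigma_preimage (fun i t => f t ord0 i) `<=` @measurable _ T.
  apply: smallest_sub; first exact: sigma_algebra_measurable.
  case: d => [|d] in f mf *; first by rewrite big_ord0.
  rewrite -bigcup_mkord_ord; apply: bigcup_sub => i Ii.
  by move=> A [B mB <-]; exact: mf.
move=> _ A mA; apply: H.
rewrite (@g_sigma_preimage_comp _ _ _ _ (fun i (x : 'rV[R]_d) => x ord0 i) _ f).
by exists A.
Qed.

Definition cons_rV (R : realType) (d : nat) (p : measurableTypeR R * 'rV[R]_d) :
  'rV[R]_d.+1 := row_mx (p.1 : R)%:M p.2.

Lemma measurable_cons_rV (R : realType) (d : nat) :
  measurable_fun [set: measurableTypeR R * 'rV[R]_d] (@cons_rV R d).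
Proof.
apply: measurable_fun_rVP => i.
rewrite [X in measurable_fun _ X](_ : _ =
  fun p : measurableTypeR R * 'rV[R]_d =>
    match fintype.split (i : 'I_(1 + d)) with
    | inl _ => (p.1 : R) | inr j => p.2 ord0 j end); last first.
  apply/funext => p; rewrite /cons_rV mxE; case: fintype.split => // j.
  by rewrite [j]ord1 mxE.
case: fintype.split => j; first exact: measurable_fst.
exact: (measurableT_comp (@measurable_coor R d j) measurable_snd).
Qed.

Section cons_measure.
Context (R : realType) (d : nat).
Variables (mu : {sigma_finite_measure set (measurableTypeR R) -> \bar R})
          (nu : {measure set 'rV[R]_d -> \bar R}).

(* the product of mu and nu, transported to R^(d+1) *)
Definition cons_measure : set 'rV[R]_d.+1 -> \bar R :=
  pushforward (mu \x^ nu)%E (@cons_rV R d).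

Let mcons := @measurable_cons_rV R d.

Let cons_measure0 : cons_measure set0 = 0%E.
Proof. by rewrite /cons_measure /pushforward preimage_set0 measure0. Qed.

Let cons_measure_ge0 A : (0 <= cons_measure A)%E.
Proof. by rewrite /cons_measure /pushforward; exact: integral_ge0. Qed.

Let cons_measure_sigma_additive : semi_sigma_additive cons_measure.
Proof.
move=> F mF tF mUF; rewrite /cons_measure.
by apply: (measure_semi_sigma_additive (s := pushforward _ _)) => //; exact: mcons.
Qed.

HB.instance Definition _ := isMeasure.Build _ _ _ cons_measure
  cons_measure0 cons_measure_ge0 cons_measure_sigma_additive.

End cons_measure.

(* mu x ... x mu (d factors) *)
Fixpoint power_measure (R : realType)
    (mu : {sigma_finite_measure set (measurableTypeR R) -> \bar R}) (d : nat) :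
    {measure set 'rV[R]_d -> \bar R} :=
  match d with
  | 0 => dirac (0 : 'rV[R]_0)
  | d'.+1 => cons_measure mu (power_measure mu d')
  end.

Definition lebesgue_rV (R : realType) (d : nat) :
  {measure set 'rV[R]_d -> \bar R} := power_measure (@lebesgue_measure R) d.

Definition gauss_rV (R : realType) (d : nat) :
  {measure set 'rV[R]_d -> \bar R} := power_measure (normal_prob (0 : R) 1) d.

(* x'' = - grad f x, x 0 = x0, x' 0 = v *)
Definition hamiltonian_solution (R : realType) (d : nat) (f : 'rV[R]_d -> R)
    (x0 v : 'rV[R]_d) (x : R -> 'rV[R]_d) : Prop :=
  [/\ x 0 = x0, derive1 x 0 = v, (forall t : R, derivable x t 1) &
      forall t : R, is_derive t 1 (derive1 x) (- grad f (x t))].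

Definition hmc_theta (R : realType) (m2 h : R) : R := m2 * h ^+ 2 / 8.

Definition hmc_scale (R : realType) (d : nat) (f : 'rV[R]_d -> R) (m2 : R)
  (x0 : 'rV[R]_d) : R := l2norm (grad f x0) ^+ 2 / m2 + d%:R.

(* The real number defining N is rounded up, and N = 0 when the logarithm is  *)
(* negative (a loop over k = 1, ..., N with N <= 0 is empty).                 *)
Definition hmc_iters (R : realType) (d : nat) (f : 'rV[R]_d -> R) (m2 : R)
    (x0 : 'rV[R]_d) (eps h : R) : nat :=
  absz (Num.max 0 (Num.ceil ((hmc_theta m2 h)^-1 *
                             ln (4 / eps ^+ 2 * hmc_scale f m2 x0)))).

Definition hmc_tol (R : realType) (m2 eps h : R) : R :=
  hmc_theta m2 h * eps / (2 * Num.sqrt m2).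

(* Events determined by X_0, ..., X_k and V_0, ..., V_(k-1), where V_j is the *)
(* velocity used to go from X_j to X_(j+1).                                   *)
Definition history (dO : measure_display) (Omega : measurableType dO)
    (R : realType) (d : nat) (V X : nat -> Omega -> 'rV[R]_d) (k : nat) :
    set (set Omega) :=
  <<s \bigcup_(j in [set j | (j <= k)%N])
        preimage_set_system setT (X j) measurable `|`
      \bigcup_(j in [set j | (j < k)%N])
        preimage_set_system setT (V j) measurable >>.

(* A run of the procedure on a probability space. The point X_(k+1) may be    *)
(* any measurable (possibly randomized, history-dependent) choice within the  *)
(* tolerance; the fresh velocity V_k is independent of the history.           *)
Record hmc_run (R : realType) (d : nat) (x0 : 'rV[R]_d) (f : 'rV[R]_d -> R)
    (m2 eps h : R) (dO : measure_display) (Omega : measurableType dO)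
    (P : probability Omega R) (V X : nat -> {RV P >-> 'rV[R]_d}) : Prop := {
  hmc_start : forall w, X 0 w = x0;
  hmc_gauss : forall k, (k < hmc_iters f m2 x0 eps h)%N ->
    forall B, measurable B -> distribution P (V k) B = gauss_rV R d B;
  hmc_indep : forall k, (k < hmc_iters f m2 x0 eps h)%N ->
    forall A B, history V X k A -> measurable B ->
      P (A `&` V k @^-1` B) = (P A * P (V k @^-1` B))%E;
  hmc_step : forall k, (k < hmc_iters f m2 x0 eps h)%N ->
    forall w, exists2 x : R -> 'rV[R]_d,
      hamiltonian_solution f (X k w) (V k w) x &
      l2norm (X k.+1 w - x h) <= hmc_tol m2 eps h
}.

Definition density_prop_exp (R : realType) (d : nat) (f : 'rV[R]_d -> R)
    (mu : set 'rV[R]_d -> \bar R) : Prop :=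
  exists2 c : R, 0 < c &
    forall A, measurable A ->
      mu A = (\int[lebesgue_rV R d]_(x in A) (c * expR (- f x))%:E)%E.

Definition coupling (R : realType) (d : nat) (mu nu : probability 'rV[R]_d R) :
    set (probability ('rV[R]_d * 'rV[R]_d)%type R) :=
  [set g | forall A, measurable A ->
     g (fst @^-1` A) = mu A /\ g (snd @^-1` A) = nu A].

Definition W2 (R : realType) (d : nat) (mu nu : probability 'rV[R]_d R) :
    \bar R :=
  sqrte (ereal_inf [set (\int[g]_p (l2norm (p.1 - p.2) ^+ 2)%:E)%E
                   | g in coupling mu nu]).

(* Main.v *)
Require Import Defs.
From HB Require Import structures.
From mathcomp Require Import all_boot all_order all_algebra.
From mathcomp Require Import all_classical all_reals all_analysis.
From mathcomp Require Import measurable_realfun ring lra.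
Set Implicit Arguments.
Unset Strict Implicit.
Unset Printing Implicit Defensive.
Import Order.TTheory GRing.Theory Num.Theory.
Import numFieldNormedType.Exports.
Local Open Scope classical_set_scope.
Local Open Scope ring_scope.

(* Couple the run with the ideal chain that starts at the target [Y], uses the
   same velocities and follows the Hamiltonian flow exactly.
   - When [M2 h^2 <= 1/4], two trajectories with the same initial velocity get
     closer by a factor [1 - theta] at time [h]. Hence, pointwise, the distance
     after [N] steps is at most [lam |x0 - Y| + (1 - lam) eps / (2 sqrt m2)]
     with [lam = (1 - theta)^N].
   - The ideal chain stays distributed as the target. Instead of Liouville's
     theorem, which would need the differentiability of the flow in its initial
     condition, the flow is written as a pointwise limit of symplectic Euler
     schemes. These are compositions of shears, which preserve the Lebesgue
     measure by Fubini and translation invariance; Fatou's lemma and the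
     conservation of energy give the inequality [law of the flow <= target] on
     open sets, which is an equality for probability measures.
   - Comparing the masses of [exp (- f)] and of a dilation of it centred at [x0]
     bounds [E |x0 - Y|^2] by [3 (|grad f x0|^2 / m2 + d) / m2].
   Squaring the first bound by convexity and integrating it gives the result. *)

(** * Euclidean geometry and gradients *)

(** The Hessian of [f] need not be continuous, so no integral of it along a segment is available:
    mean value inequalities take the place of such integrals. The contraction does use one integral,
    [P t] of [<g, u>] over [[0, t]], where [u] is the difference of two positions and [g] that of
    the gradients; its integrand is continuous. Co-coercivity bounds the kinetic term [|u'|^2] by
    [M2 t P t], which is dominated by the decrease that [P] forces on [|u|^2]. Fatou's lemma gives
    only an inequality, because the indicator of an open set passes to the limit only at points
    whose flow ends in that set. Constants: the tolerance is [theta] times [eps / (2 sqrt m2)], so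
    that errors add up to a convex combination; [N] is such that
    [4 lam (|grad f x0|^2 / m2 + d) <= eps^2]. With the constant 3 of the second moment, the
    starting distance costs at most 3/4 of [eps^2 / m2] and the tolerances at most 1/4. *)

Section dot_product.
Context {R : realType} {d : nat}.
Implicit Types u v w : 'rV[R]_d.

Definition dotv u v : R := \sum_(i < d) u ord0 i * v ord0 i.

Lemma dotvC u v : dotv u v = dotv v u.
Proof. by apply: eq_bigr => i _; rewrite mulrC. Qed.

Lemma dotvDl u v w : dotv (u + v) w = dotv u w + dotv v w.
Proof. by rewrite -big_split; apply: eq_bigr => i _; rewrite mxE mulrDl. Qed.

Lemma dotvZl a u w : dotv (a *: u) w = a * dotv u w.
Proof. by rewrite mulr_sumr; apply: eq_bigr => i _; rewrite mxE mulrA. Qed.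

Lemma dotvNl u w : dotv (- u) w = - dotv u w.
Proof. by rewrite -scaleN1r dotvZl mulN1r. Qed.

Lemma dotvBl u v w : dotv (u - v) w = dotv u w - dotv v w.
Proof. by rewrite dotvDl dotvNl. Qed.

Lemma dotvDr u v w : dotv w (u + v) = dotv w u + dotv w v.
Proof. by rewrite dotvC dotvDl !(dotvC w). Qed.

Lemma dotvZr a u w : dotv w (a *: u) = a * dotv w u.
Proof. by rewrite dotvC dotvZl dotvC. Qed.

Lemma dotvNr u w : dotv w (- u) = - dotv w u.
Proof. by rewrite dotvC dotvNl dotvC. Qed.

Lemma dotvBr u v w : dotv w (u - v) = dotv w u - dotv w v.
Proof. by rewrite dotvDr dotvNr. Qed.

Lemma dot0v w : dotv 0 w = 0.
Proof. by rewrite -(scale0r 0) dotvZl mul0r. Qed.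

Lemma dotvv_ge0 u : 0 <= dotv u u.
Proof. by apply: sumr_ge0 => i _; rewrite -expr2 sqr_ge0. Qed.

Lemma sqr_l2norm u : l2norm u ^+ 2 = dotv u u.
Proof.
rewrite /l2norm sqr_sqrtr; last by apply: sumr_ge0 => i _; rewrite sqr_ge0.
by apply: eq_bigr => i _; rewrite expr2.
Qed.

Lemma l2norm_ge0 u : 0 <= l2norm u. Proof. exact: sqrtr_ge0. Qed.

Lemma l2norm_dot u : l2norm u = Num.sqrt (dotv u u).
Proof. by congr Num.sqrt; apply: eq_bigr => i _; rewrite expr2. Qed.

Lemma l2normN u : l2norm (- u) = l2norm u.
Proof. by rewrite !l2norm_dot dotvNl dotvNr opprK. Qed.

Lemma l2norm0 : l2norm (0 : 'rV[R]_d) = 0.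
Proof. by rewrite l2norm_dot dot0v sqrtr0. Qed.

Lemma l2normBC u v : l2norm (u - v) = l2norm (v - u).
Proof. by rewrite -l2normN opprB. Qed.

Lemma l2normZ a u : l2norm (a *: u) = `|a| * l2norm u.
Proof.
by rewrite !l2norm_dot dotvZl dotvZr mulrA -expr2 sqrtrM ?sqr_ge0// sqrtr_sqr.
Qed.

Lemma l2norm_eq0 u : l2norm u = 0 -> u = 0.
Proof.
move=> u0; apply/rowP => i; rewrite mxE.
have /eqP : dotv u u = 0 by rewrite -sqr_l2norm u0 expr0n.
rewrite psumr_eq0 => [/allP/(_ i (mem_index_enum _))|j _]; last first.
  by rewrite -expr2 sqr_ge0.
by rewrite -expr2 sqrf_eq0 => /eqP.
Qed.

(** Cauchy-Schwarz, from the square of [l2norm v *: u - l2norm u *: v]; null vectors are set apart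
    since one divides by the product of the norms. *)
Lemma dotv_le u v : dotv u v <= l2norm u * l2norm v.
Proof.
have [/l2norm_eq0 ->|u0] := eqVneq (l2norm u) 0; first by rewrite dot0v l2norm0 mul0r.
have [/l2norm_eq0 ->|v0] := eqVneq (l2norm v) 0.
  by rewrite dotvC dot0v l2norm0 mulr0.
have {}u0 : 0 < l2norm u by rewrite lt_def u0 l2norm_ge0.
have {}v0 : 0 < l2norm v by rewrite lt_def v0 l2norm_ge0.
have := dotvv_ge0 (l2norm v *: u - l2norm u *: v).
rewrite dotvBl !dotvBr !dotvZl !dotvZr -!sqr_l2norm (dotvC v u).
set a := l2norm u in u0 *; set b := l2norm v in v0 *; set c := dotv u v => H.
have ab : 0 < a * b by rewrite mulr_gt0.
by rewrite -(ler_pM2l ab); nra.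
Qed.

Lemma ler_l2normD u v : l2norm (u + v) <= l2norm u + l2norm v.
Proof.
have h0 := addr_ge0 (l2norm_ge0 u) (l2norm_ge0 v).
rewrite -ler_sqr ?nnegrE ?l2norm_ge0// sqr_l2norm dotvDl !dotvDr (dotvC v u).
rewrite -!sqr_l2norm; have := dotv_le u v; nra.
Qed.

Lemma ler_l2normB u v : l2norm (u - v) <= l2norm u + l2norm v.
Proof. by rewrite -(l2normN v) ler_l2normD. Qed.

Lemma ler_l2norm_dist w u v : l2norm (u - v) <= l2norm (u - w) + l2norm (w - v).
Proof. by rewrite -(subrKA w u (- v)) ler_l2normD. Qed.

Lemma ler_coor_l2norm u i : `|u ord0 i| <= l2norm u.
Proof.
rewrite -sqrtr_sqr ler_sqrt; last by apply: sumr_ge0 => j _; rewrite sqr_ge0.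
by rewrite (bigD1 i)//= lerDl; apply: sumr_ge0 => j _; rewrite sqr_ge0.
Qed.

(** Test against [u] itself. This reduces bounds on vector increments to scalar ones. *)
Lemma l2norm_dual u (B : R) : 0 <= B ->
  (forall a, dotv u a <= B * l2norm a) -> l2norm u <= B.
Proof.
move=> B0 /(_ u); rewrite -sqr_l2norm expr2 => H.
have [u0|u0] := eqVneq (l2norm u) 0; first by rewrite u0.
by move: H; rewrite ler_pM2r// lt_def u0 l2norm_ge0.
Qed.

End dot_product.

(** * Derivatives of curves and mean value inequalities *)

Section row_calculus.
Context {R : realType} {d : nat}.
Implicit Types x y : R -> 'rV[R]_d.

Lemma is_derive_row x (t : R) (dx : 'rV[R]_d) :
  (forall i, is_derive t 1 (fun s => x s ord0 i) (dx ord0 i)) ->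
  is_derive t 1 x dx.
Proof.
move=> H; have dvx : derivable x t 1.
  by apply/derivable_mxP => i j; rewrite (ord1 i); case: (H j).
apply: DeriveDef => //; rewrite derive_mx//.
by apply/rowP => j; rewrite mxE; case: (H j).
Qed.

Lemma is_derive_coor x (t : R) (dx : 'rV[R]_d) i :
  is_derive t 1 x dx -> is_derive t 1 (fun s => x s ord0 i) (dx ord0 i).
Proof.
case=> dvx <-; apply: DeriveDef; first by move/derivable_mxP : dvx; exact.
by rewrite derive_mx// mxE.
Qed.

Lemma is_derive_dotv x y (t : R) (dx dy : 'rV[R]_d) :
  is_derive t 1 x dx -> is_derive t 1 y dy ->
  is_derive t 1 (fun s => dotv (x s) (y s)) (dotv dx (y t) + dotv (x t) dy).
Proof.
move=> Hx Hy.
rewrite (_ : (fun s => _) = \sum_(i < d) ((fun s => x s ord0 i) * (fun s => y s ord0 i))); last first.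
  by apply/funext => s; rewrite fct_sumE.
rewrite /dotv -big_split/=; apply: is_derive_sum => i.
have := is_deriveM (is_derive_coor i Hx) (is_derive_coor i Hy).
move=> /is_derive_eq; apply.
by rewrite addrC; congr (_ + _); rewrite /GRing.scale/= mulrC.
Qed.

Lemma is_derive_dotvl x (t : R) (dx a : 'rV[R]_d) :
  is_derive t 1 x dx -> is_derive t 1 (fun s => dotv (x s) a) (dotv dx a).
Proof.
move=> Hx; have := is_derive_dotv Hx (is_derive_cst a t 1).
by move=> /is_derive_eq; apply; rewrite dotvC (dotvC _ 0) dot0v addr0 dotvC.
Qed.

Lemma is_derive_continuous (V : normedModType R) (x : R -> V) (t : R) (dx : V) :
  is_derive t 1 x dx -> {for t, continuous x}.
Proof. by case=> /derivable1_diffP /differentiable_continuous. Qed.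

(** Stands for the integration of a bound on [dg], with [dg] possibly discontinuous. *)
Lemma MVT_le (g dg : R -> R) (a b B : R) : a <= b ->
  (forall t : R, a <= t <= b -> is_derive t 1 g (dg t)) ->
  (forall t : R, a < t < b -> dg t <= B) -> g b - g a <= B * (b - a).
Proof.
rewrite le_eqVlt => /predU1P[-> _ _|ab dgg dgB]; first by rewrite !subrr mulr0.
have [||c cab ->] := @MVT _ g dg _ _ ab.
- by move=> t /[!in_itv]/= /andP[at_ tb]; apply: dgg; rewrite !ltW.
- apply: derivable_within_continuous => t /[!in_itv]/= tab.
  by case: (dgg t tab).
- by rewrite ler_pM2r ?subr_gt0// dgB//; move: cab; rewrite in_itv.
Qed.

(** The scalar inequality for [dotv (x t) c], for each fixed [c], followed by duality. *)
Lemma MVT_l2norm x (dx : R -> 'rV[R]_d) (a b B : R) : a <= b -> 0 <= B ->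
  (forall t : R, a <= t <= b -> is_derive t 1 x (dx t)) ->
  (forall t : R, a <= t <= b -> l2norm (dx t) <= B) ->
  l2norm (x b - x a) <= B * (b - a).
Proof.
move=> ab B0 dxx dxB; apply: l2norm_dual => [|c].
  by rewrite mulr_ge0// subr_ge0.
rewrite dotvBl -mulrA (mulrC (b - a)) mulrA.
apply: (@MVT_le (fun t => dotv (x t) c) (fun t => dotv (dx t) c)) => //.
  by move=> t tab; apply: is_derive_dotvl; exact: dxx.
move=> t /andP[at_ tb]; apply: (le_trans (dotv_le _ _)).
by rewrite ler_wpM2r ?l2norm_ge0// dxB// !ltW.
Qed.

End row_calculus.

Section chain_rule.
Context {R : realType} {d : nat}.

Lemma is_derive_diff_comp (W : normedModType R) (g : 'rV[R]_d -> W)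
    (x : R -> 'rV[R]_d) (t : R) (dx : 'rV[R]_d) :
  differentiable g (x t) -> is_derive t 1 x dx ->
  is_derive t 1 (fun s => g (x s)) ('d g (x t) dx).
Proof.
move=> dg [/derivable1_diffP dfx <-].
have dgx : differentiable (g \o x) t by exact: differentiable_comp.
apply: DeriveDef; first exact/derivable1_diffP.
by rewrite deriveE// diff_comp// deriveE.
Qed.

Lemma diff_grad (f : 'rV[R]_d -> R) (x u : 'rV[R]_d) :
  differentiable f x -> 'd f x u = dotv (grad f x) u.
Proof.
move=> dfx; rewrite [in LHS](row_sum_delta u) linear_sum; apply: eq_bigr => i _.
by rewrite linearZ/= -deriveE// mxE mulrC.
Qed.

Lemma mulmx_dotv (u v : 'rV[R]_d) (A : 'M[R]_d) :
  (u *m A *m v^T) ord0 ord0 = dotv (u *m A) v.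
Proof. by rewrite [in LHS]mxE; apply: eq_bigr => i _; rewrite [v^T _ _]mxE. Qed.

Lemma is_derive_line (y w : 'rV[R]_d) (s : R) :
  is_derive s 1 (fun r : R => y + r *: w) w.
Proof.
apply: is_derive_row => i.
rewrite (_ : (fun r => _) = cst (y ord0 i) + (fun r : R => r * w ord0 i)); last first.
  by apply/funext => r; rewrite !mxE.
have : is_derive s 1 (cst (y ord0 i) + (fun r : R => r * w ord0 i)) (0 + w ord0 i).
  apply: is_deriveD.
  have := is_deriveM (is_derive_id s 1) (is_derive_cst (w ord0 i) s 1).
  move=> /is_derive_eq; apply.
  by rewrite scaler0 add0r /GRing.scale/= mulr1.
by rewrite add0r.
Qed.

End chain_rule.

(** * Consequences of the Hessian bounds *)

Section well_conditioned.
Context {R : realType} {d : nat}.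
Variables (f : 'rV[R]_d -> R) (m2 M2 : R).
Hypothesis wcf : well_conditioned f m2 M2.

Lemma wc_m2_gt0 : 0 < m2. Proof. by case: wcf. Qed.

Lemma wc_m2M2 : m2 <= M2. Proof. by case: wcf. Qed.

Lemma wc_M2_gt0 : 0 < M2. Proof. exact: lt_le_trans wc_m2_gt0 wc_m2M2. Qed.

Lemma wc_differentiable x : differentiable f x.
Proof. by case: wcf => _ _ []. Qed.

Lemma wc_differentiable_grad x : differentiable (grad f) x.
Proof. by case: wcf => _ _ []. Qed.

Lemma wc_continuous : continuous f.
Proof. move=> x; exact/differentiable_continuous/wc_differentiable. Qed.

Lemma wc_continuous_grad : continuous (grad f).
Proof. move=> x; exact/differentiable_continuous/wc_differentiable_grad. Qed.

Lemma is_derive_fcomp (x : R -> 'rV[R]_d) (t : R) (dx : 'rV[R]_d) :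
  is_derive t 1 x dx ->
  is_derive t 1 (fun s => f (x s)) (dotv (grad f (x t)) dx).
Proof.
move=> dxx; have := is_derive_diff_comp (wc_differentiable (x t)) dxx.
by rewrite diff_grad//; exact: wc_differentiable.
Qed.

Lemma is_derive_gradcomp (x : R -> 'rV[R]_d) (t : R) (dx : 'rV[R]_d) :
  is_derive t 1 x dx ->
  is_derive t 1 (fun s => grad f (x s)) (dx *m hessian f (x t)).
Proof.
move=> dxx; have := is_derive_diff_comp (wc_differentiable_grad (x t)) dxx.
by rewrite /hessian /jacobian mul_rV_lin1.
Qed.

Lemma hessian_ge x u : m2 * dotv u u <= dotv (u *m hessian f x) u.
Proof.
case: wcf => _ _ _ /(_ x)[[_ /(_ u) +] _].
rewrite mulmx_dotv mulmxBr dotvBl subr_ge0.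
by rewrite mul_mx_scalar dotvZl.
Qed.

Lemma hessian_le x u : dotv (u *m hessian f x) u <= M2 * dotv u u.
Proof.
case: wcf => _ _ _ /(_ x)[_ [_ /(_ u) +]].
rewrite mulmx_dotv mulmxBr dotvBl subr_ge0.
by rewrite mul_mx_scalar dotvZl.
Qed.

Lemma hessian_sym x u v :
  dotv (u *m hessian f x) v = dotv (v *m hessian f x) u.
Proof.
case: wcf => _ _ _ /(_ x)[[+ _] _].
rewrite linearB/= tr_scalar_mx => /addIr hT.
rewrite -!mulmx_dotv -[in LHS]hT -[v *m _ *m _]trmxK [in RHS]mxE.
by rewrite !trmx_mul trmxK mulmxA.
Qed.

(** The derivative along the line is the Hessian form at [w]. Signs are flipped because [MVT_le]
    bounds increments from above. *)
Lemma grad_line_mono (y w : 'rV[R]_d) (r s : R) : r <= s ->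
  m2 * dotv w w * (s - r) <=
  dotv (grad f (y + s *: w)) w - dotv (grad f (y + r *: w)) w.
Proof.
move=> rs; rewrite -lerN2 opprB -mulNr.
have := @MVT_le _ (fun s => - dotv (grad f (y + s *: w)) w)
  (fun s => - dotv (w *m hessian f (y + s *: w)) w) r s (- (m2 * dotv w w)) rs.
rewrite opprK [X in _ -> X <= _ ]addrC; apply.
  move=> t _; apply: is_deriveN; apply: is_derive_dotvl; apply: is_derive_gradcomp.
  exact: is_derive_line.
by move=> t _; rewrite lerN2 hessian_ge.
Qed.

Lemma grad_mono (x y : 'rV[R]_d) :
  m2 * dotv (x - y) (x - y) <= dotv (grad f x - grad f y) (x - y).
Proof.
have := grad_line_mono y (x - y) ler01.
by rewrite subr0 mulr1 scale1r scale0r addr0 -dotvBl (addrC y) subrK.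
Qed.

(* If [A] is a Hessian and [w = x - y] then positivity of [A] at
   [M2 w - b] gives [<A w, 2 b - M2 w> <= <A b, b> / M2 <= |b|^2]; integrate
   along the segment and take [b = grad f x - grad f y]. *)
Lemma grad_cocoercive (x y : 'rV[R]_d) :
  dotv (grad f x - grad f y) (grad f x - grad f y) <=
  M2 * dotv (grad f x - grad f y) (x - y).
Proof.
set w := x - y; set b := grad f x - grad f y.
have M0 := wc_M2_gt0.
have := @MVT_le _ (fun s => dotv (grad f (y + s *: w)) (2 *: b - M2 *: w))
  (fun s => dotv (w *m hessian f (y + s *: w)) (2 *: b - M2 *: w)) 0 1
  (dotv b b) ler01.
rewrite scale1r scale0r addr0 /w (addrC y) subrK -/w -dotvBl -/b subr0 mulr1.
rewrite (dotvBr (2 *: b)) !dotvZr => H; clearbody w b.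
suff : 2 * dotv b b - M2 * dotv b w <= dotv b b by lra.
apply: H => [t _|t _].
  apply: is_derive_dotvl; apply: is_derive_gradcomp; exact: is_derive_line.
have := hessian_ge (y + t *: w) (M2 *: w - b).
have := hessian_le (y + t *: w) b.
set A := hessian _ _.
have h0 := dotvv_ge0 (M2 *: w - b); have m0 := wc_m2_gt0.
rewrite mulmxBl -scalemxAl !dotvBl !dotvBr !dotvZl !dotvZr.
rewrite (hessian_sym _ b w) -/A => H1 H2.
have {h0 m0}h0 : 0 <= m2 * dotv (M2 *: w - b) (M2 *: w - b) by rewrite mulr_ge0// ltW.
move: h0 H2; rewrite !dotvBl !dotvBr !dotvZl !dotvZr => h0 H2.
rewrite -(ler_pM2l M0); nra.
Qed.

(** Cauchy-Schwarz in the co-coercivity inequality, then division by the norm of the gradient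
    difference. *)
Lemma grad_lipschitz (x y : 'rV[R]_d) :
  l2norm (grad f x - grad f y) <= M2 * l2norm (x - y).
Proof.
have := grad_cocoercive x y; rewrite -sqr_l2norm expr2 => H.
have [->|g0] := eqVneq (l2norm (grad f x - grad f y)) 0.
  by rewrite mulr_ge0 ?l2norm_ge0// ltW// wc_M2_gt0.
have {}g0 : 0 < l2norm (grad f x - grad f y) by rewrite lt_def g0 l2norm_ge0.
rewrite -(ler_pM2l g0); apply: (le_trans H).
rewrite mulrCA ler_pM2l ?wc_M2_gt0//; exact: dotv_le.
Qed.

End well_conditioned.

(** * Hamiltonian trajectories *)

Section pointwise_derivatives.
Context {R : realType}.
Implicit Types (f g : R -> R) (t : R).

Lemma is_derive_fctD (V : normedModType R) (f g : R -> V) t df dg :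
  is_derive t 1 f df -> is_derive t 1 g dg ->
  is_derive t 1 (fun s => f s + g s) (df + dg).
Proof. by move=> *; exact: is_deriveD. Qed.

Lemma is_derive_fctB (V : normedModType R) (f g : R -> V) t df dg :
  is_derive t 1 f df -> is_derive t 1 g dg ->
  is_derive t 1 (fun s => f s - g s) (df - dg).
Proof. by move=> *; exact: is_deriveB. Qed.

Lemma is_derive_fctM f g t df dg :
  is_derive t 1 f df -> is_derive t 1 g dg ->
  is_derive t 1 (fun s => f s * g s) (df * g t + f t * dg).
Proof.
move=> Hf Hg; have := is_deriveM Hf Hg; move=> /is_derive_eq; apply.
by rewrite addrC; congr (_ + _); rewrite /GRing.scale/= mulrC.
Qed.

Lemma is_derive_fctMl (k : R) g t dg :
  is_derive t 1 g dg -> is_derive t 1 (fun s => k * g s) (k * dg).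
Proof.
move=> Hg; have := is_derive_fctM (is_derive_cst k t 1) Hg.
by rewrite mul0r add0r.
Qed.

Lemma is_derive_fct_cst (k t : R) : is_derive t 1 (fun _ : R => k) 0.
Proof. exact: (is_derive_cst k t 1). Qed.

Lemma is_derive_sqr t : is_derive t 1 (fun s : R => s ^+ 2) (2 * t).
Proof.
rewrite (_ : (fun s => _) = (fun s : R => s * s)); last by apply/funext => s; rewrite expr2.
have := is_derive_fctM (is_derive_id t 1) (is_derive_id t 1).
by move=> /is_derive_eq; apply; rewrite mul1r mulr1 mulr2n mulrDl mul1r.
Qed.

End pointwise_derivatives.

(** * Antiderivatives of functions continuous on a segment *)

Section antiderivative.
Context {R : realType}.

(** The retraction of the line onto [[0, h]] when [0 <= h]: composing with it extends a function
    from the segment to a continuous one on the line. *)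
Definition clamp (h t : R) : R := Num.max 0 (Num.min t h).

Lemma clampK (h t : R) : 0 <= t <= h -> clamp h t = t.
Proof. by move=> /andP[t0 th]; rewrite /clamp min_l// max_r. Qed.

Lemma clamp_itv (h t : R) : 0 <= h -> 0 <= clamp h t <= h.
Proof. by move=> h0; rewrite /clamp le_max lexx/= ge_max h0 ge_min lexx orbT. Qed.

Lemma continuous_clamp (h : R) : continuous (clamp h).
Proof.
move=> t; apply: (@continuous_max _ _ (cst 0) (fun s => Num.min s h)).
  exact: cst_continuous.
by apply: (@continuous_min _ _ id (cst h)); [exact: cvg_id|exact: cst_continuous].
Qed.

(** Integrating from [-1] makes [0] an interior point, so the derivative there is two-sided. *)
Lemma continuous_antiderivative (g : R -> R) : continuous g ->
  exists G : R -> R, forall t : R, -1 < t -> is_derive t 1 G (g t).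
Proof.
move=> cg; exists (fun t => \int[lebesgue_measure]_(s in `[-1, t]) g s)%R => t t1.
have ig : lebesgue_measure.-integrable `[-1, t + 1] (EFin \o g).
  apply: continuous_compact_integrable; first exact: segment_compact.
  exact: continuous_subspaceT.
have tt : t < t + 1 by rewrite ltrDl.
have [dG G'] := continuous_FTC1_closed tt ig t1 (cg t).
by apply: DeriveDef; [exact: dG|rewrite -derive1E].
Qed.

Lemma segment_antiderivative (g : R -> R) (h : R) : 0 <= h ->
  (forall t : R, 0 <= t <= h -> {for t, continuous g}) ->
  exists G : R -> R, G 0 = 0 /\ forall t : R, 0 <= t <= h -> is_derive t 1 G (g t).
Proof.
move=> h0 cg; have [|G dG] := @continuous_antiderivative (g \o clamp h).
  move=> t; apply: continuous_comp; first exact: continuous_clamp.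
  exact/cg/clamp_itv.
exists (fun t => G t - G 0); split=> [|t th]; first by rewrite subrr.
have := dG t; rewrite /= clampK// => dGt.
rewrite -[g t]subr0; apply: (is_derive_fctB _ (is_derive_fct_cst (G 0) t)).
by apply: dGt; case/andP: th => t0 _; rewrite (lt_le_trans _ t0)// ltrN10.
Qed.

End antiderivative.

(** * Contraction for [u'' = - g] when [u' 0 = 0] *)

Section contraction.
Context {R : realType} {d : nat}.
Variables (u du g : R -> 'rV[R]_d) (P : R -> R) (m M h : R).
Hypotheses (m0 : 0 < m) (mM : m <= M) (h0 : 0 < h) (Mh : M * h ^+ 2 <= 4^-1).
Hypothesis du0 : du 0 = 0.
Hypothesis uE : forall t : R, 0 <= t <= h -> is_derive t 1 u (du t).
Hypothesis duE : forall t : R, 0 <= t <= h -> is_derive t 1 du (- g t).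
Hypothesis PE : forall t : R, 0 <= t <= h -> is_derive t 1 P (dotv (g t) (u t)).
Hypothesis P0 : P 0 = 0.
Hypothesis gm : forall t : R, 0 <= t <= h ->
  m * dotv (u t) (u t) <= dotv (g t) (u t).
Hypothesis gM : forall t : R, 0 <= t <= h ->
  dotv (g t) (g t) <= M * dotv (g t) (u t).

Let M0 : 0 < M. Proof. exact: lt_le_trans mM. Qed.

Let gu_ge0 (t : R) : 0 <= t <= h -> 0 <= dotv (g t) (u t).
Proof.
by move=> th; apply: le_trans (gm th); rewrite mulr_ge0 ?dotvv_ge0// ltW.
Qed.

Let P_ge0 (t : R) : 0 <= t <= h -> 0 <= P t.
Proof.
move=> /andP[t0 th].
have := @MVT_le _ (fun s => - P s) (fun s => - dotv (g s) (u s)) 0 t 0 t0.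
rewrite P0 oppr0 mul0r subr0 oppr_le0; apply.
  by move=> s /andP[s0 st]; apply: is_deriveN; apply: PE; rewrite s0 (le_trans st).
by move=> s /andP[s0 st]; rewrite oppr_le0 gu_ge0// (ltW s0) (le_trans (ltW st)).
Qed.

(* Cauchy-Schwarz for the integral of [g], by testing [du] against its final
   value. *)
Let du_le (t : R) : 0 <= t <= h -> dotv (du t) (du t) <= M * t * P t.
Proof.
move=> /andP[]; rewrite le_eqVlt => /predU1P[<- _|t0 th].
  by rewrite du0 dot0v mulr0 mul0r.
set a := du t; set K := dotv a a.
have := @MVT_le _ (fun s => dotv (du s) a - t / 2 * M * P s)
  (fun s => dotv (- g s) a - t / 2 * M * dotv (g s) (u s)) 0 t (K / (2 * t)) (ltW t0).
rewrite du0 dot0v P0 mulr0 !subr0 -/a -/K.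
have -> : K / (2 * t) * t = K / 2 by field; rewrite gt_eqF.
move=> H.
suff : K - t / 2 * M * P t <= K / 2 by lra.
apply: H => [s /andP[s0 st]|s /andP[s0 st]].
  have sh : 0 <= s <= h by rewrite s0 (le_trans st).
  apply: is_derive_fctB; first exact/is_derive_dotvl/duE.
  exact/is_derive_fctMl/PE.
have sh : 0 <= s <= h by rewrite (ltW s0) (le_trans (ltW st)).
have := dotvv_ge0 (t *: g s + a); rewrite dotvDl !dotvDr !dotvZl !dotvZr.
rewrite dotvNl (dotvC a) -/K; have := gM sh.
move: (dotv (g s) (g s)) (dotv (g s) (u s)) (dotv (g s) a) => gg gu ga H1 H2.
rewrite ler_pdivlMr ?mulr_gt0//.
have : t ^+ 2 * gg <= t ^+ 2 * (M * gu) by rewrite ler_pM2l// exprn_gt0.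
by nra.
Qed.

(** In the derivative of [<u, du> + (1 - M / 2 * s ^+ 2) * P], the terms [<g, u>] cancel up to a
    nonpositive rest, and the slope [- M * s] of the weight absorbs [|du|^2] by [du_le]. The weight
    is at least [7 / 8] since [M * h ^+ 2 <= 4^-1]. *)
Let udu_le (t : R) : 0 <= t <= h -> dotv (u t) (du t) <= - (7 / 8) * P t.
Proof.
move=> th; have Pt := P_ge0 th; case/andP: th => t0 th.
have := @MVT_le _ (fun s => dotv (u s) (du s) + (1 - M / 2 * s ^+ 2) * P s)
  (fun s => dotv (du s) (du s) + dotv (u s) (- g s) +
    ((0 - M / 2 * (2 * s)) * P s + (1 - M / 2 * s ^+ 2) * dotv (g s) (u s))) 0 t 0 t0.
rewrite du0 (dotvC _ 0) dot0v P0 mulr0 mul0r addr0 subr0 => H.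
have {H} : dotv (u t) (du t) + (1 - M / 2 * t ^+ 2) * P t <= 0.
  apply: H => [s /andP[s0 st]|s /andP[s0 st]].
    have sh : 0 <= s <= h by rewrite s0 (le_trans st).
    apply: is_derive_fctD; first by apply: is_derive_dotv; [exact: uE|exact: duE].
    apply: is_derive_fctM; last exact: PE.
    apply: (is_derive_fctB (is_derive_fct_cst 1 s)).
    exact/is_derive_fctMl/is_derive_sqr.
  have sh : 0 <= s <= h by rewrite (ltW s0) (le_trans (ltW st)).
  rewrite dotvNr (dotvC (u s)); have := du_le sh; have := gu_ge0 sh.
  move: (dotv (g s) (u s)) (dotv (du s) (du s)) (P s) => p K Ps p0 H.
  have : 0 <= M / 2 * s ^+ 2 * p by rewrite !mulr_ge0// ?invr_ge0// ?sqr_ge0 ltW.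
  by nra.
have : M * t ^+ 2 <= 4^-1.
  apply: le_trans Mh; rewrite ler_pM2l// ler_sqr ?nnegrE// ltW//.
move: (dotv _ _) (P t) Pt => a b b0 H1 H2; nra.
Qed.

(** By [udu_le] the squared distance is nonincreasing. *)
Let E_ge (t : R) : 0 <= t <= h -> dotv (u h) (u h) <= dotv (u t) (u t).
Proof.
move=> /andP[t0 th]; rewrite -subr_le0.
have := @MVT_le _ (fun s => dotv (u s) (u s))
  (fun s => dotv (du s) (u s) + dotv (u s) (du s)) t h 0 th.
rewrite mul0r; apply => s /andP[ts sh].
  by apply: is_derive_dotv; apply: uE; rewrite sh (le_trans t0).
have sh' : 0 <= s <= h by rewrite ltW ?(ltW sh)// (le_lt_trans t0).
by rewrite (dotvC (du s)); have := udu_le sh'; have := P_ge0 sh'; lra.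
Qed.

(** Bounding [|u|^2] by its final, smallest value gives a linear lower bound on [P] and makes a
    differential inequality unnecessary. *)
Let P_ge (t : R) : 0 <= t <= h -> m * dotv (u h) (u h) * t <= P t.
Proof.
move=> /andP[t0 th]; set E := dotv (u h) (u h).
have := @MVT_le _ (fun s => - P s) (fun s => - dotv (g s) (u s)) 0 t (- (m * E)) t0.
rewrite P0 !oppr0 !addr0 mulNr lerN2; apply => s /andP[s0 st].
  by apply: is_deriveN; apply: PE; rewrite s0 (le_trans st).
have sh : 0 <= s <= h by rewrite (ltW s0) (le_trans (ltW st)).
rewrite lerN2; apply: le_trans (gm sh).
by rewrite ler_pM2l// E_ge.
Qed.

(** Integrating [(|u|^2)' <= - 7/4 P] with the linear bound on [P] puts the final value [E] on both
    sides: [E (1 + 7/8 m h^2) <= |u 0|^2]. *)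
Lemma second_order_contraction :
  dotv (u h) (u h) <= (1 - m * h ^+ 2 / 4) * dotv (u 0) (u 0).
Proof.
set E := dotv (u h) (u h).
(* The derivative is at most [- 7/4 P + 7/4 m E s], which is nonpositive by [P_ge]. *)
have := @MVT_le _ (fun s => dotv (u s) (u s) + 7 / 8 * m * E * s ^+ 2)
  (fun s => dotv (du s) (u s) + dotv (u s) (du s) + 7 / 8 * m * E * (2 * s)) 0 h 0 (ltW h0).
rewrite mul0r expr0n/= mulr0 addr0 => H.
have {H} : E + 7 / 8 * m * E * h ^+ 2 - dotv (u 0) (u 0) <= 0.
  apply: H => s /andP[s0 sh].
    have sh' : 0 <= s <= h by rewrite s0 sh.
    apply: is_derive_fctD; first by apply: is_derive_dotv; exact: uE.
    exact/is_derive_fctMl/is_derive_sqr.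
  have sh' : 0 <= s <= h by rewrite (ltW s0) (ltW sh).
  rewrite (dotvC (du s)); have := udu_le sh'; have := P_ge sh'; rewrite -/E.
  by move: (dotv _ _) (P s) => a b; lra.
have zle : m * h ^+ 2 <= 4^-1.
  by apply: le_trans Mh; rewrite ler_pM2r// exprn_gt0.
have z0 : 0 <= m * h ^+ 2 by rewrite mulr_ge0 ?sqr_ge0// ltW.
have E0 : 0 <= E by exact: dotvv_ge0.
move: (dotv _ _) => E1 H.
have H1 : E * (1 + 7 / 8 * (m * h ^+ 2)) <= E1 by lra.
move: (m * h ^+ 2) zle z0 H1 => z zle z0 H1.
(* For [0 <= z <= 1/4], [(1 + 7/8 z) (1 - z/4) >= 1]. *)
have : E * (1 + 7 / 8 * z) * (1 - z / 4) <= E1 * (1 - z / 4).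
  by rewrite ler_wpM2r//; lra.
have : 0 <= E * z by rewrite mulr_ge0.
have : 0 <= E * z * (4^-1 - z) by rewrite !mulr_ge0// subr_ge0.
nra.
Qed.

End contraction.

Section l2norm_topology.
Context {R : realType} {d : nat}.
Implicit Types u v : 'rV[R]_d.

(** The topology comes from the sup norm; this carries Euclidean estimates over to it. *)
Lemma mx_norm_le_l2norm u : `|u| <= l2norm u.
Proof.
rewrite [leLHS]/Num.Def.normr/= mx_normrE; apply: bigmax_le => [|i _].
  exact: l2norm_ge0.
by rewrite (ord1 i.1) ler_coor_l2norm.
Qed.

Lemma continuous_dotv (T : topologicalType) (x y : T -> 'rV[R]_d) (t : T) :
  {for t, continuous x} -> {for t, continuous y} ->
  {for t, continuous (fun s => dotv (x s) (y s))}.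
Proof.
move=> cx cy; apply: (cvg_big add_continuous) => // i _.
have cc : continuous (fun u : 'rV[R]_d => u ord0 i) by exact: coord_continuous.
by apply: cvgM; apply: (continuous_comp _ (cc _)).
Qed.

Lemma continuous_l2norm (T : topologicalType) (x : T -> 'rV[R]_d) (t : T) :
  {for t, continuous x} -> {for t, continuous (fun s => l2norm (x s))}.
Proof.
move=> cx; rewrite (_ : (fun s => _) = Num.sqrt \o (fun s => dotv (x s) (x s))).
  by apply: continuous_comp; [exact: continuous_dotv|exact: sqrt_continuous].
by apply/funext => s /=; rewrite l2norm_dot.
Qed.

Lemma l2norm_cvg0 (T : Type) (F : set_system T) (x : T -> 'rV[R]_d) (l : 'rV[R]_d) :
  Filter F -> l2norm (x t - l) @[t --> F] --> 0 -> x @ F --> l.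
Proof.
move=> FF /cvgrPdist_lt H; apply/cvgrPdist_lt => e /H.
apply: filterS => t; rewrite sub0r normrN ger0_norm ?l2norm_ge0// => te.
by apply: le_lt_trans te; rewrite distrC mx_norm_le_l2norm.
Qed.

End l2norm_topology.

Lemma geometric_small {R : realType} (C e : R) : 0 < e ->
  exists n, C * 4^-1 ^+ n < e.
Proof.
move=> e0; have z1 : `|4^-1 : R| < 1 by rewrite ger0_norm; lra.
have /cvgrPdist_lt/(_ _ e0) := cvg_geometric C z1.
case=> n _ /(_ n (leqnn n)); rewrite sub0r normrN => H; exists n.
exact: le_lt_trans (ler_norm _) H.
Qed.

(** * Trajectories on [[0, h]]: contraction, energy, existence *)

Section flow.
Context {R : realType} {d : nat}.
Variables (f : 'rV[R]_d -> R) (m2 M2 h : R).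
Hypothesis wcf : well_conditioned f m2 M2.
Hypotheses (h0 : 0 < h) (Mh : M2 * h ^+ 2 <= 4^-1).

(** First-order form on [[0, h]] alone: only the time-[h] map matters, and on this segment a Picard
    iteration converges directly. *)
Definition flow_on (x v : R -> 'rV[R]_d) : Prop :=
  (forall t : R, 0 <= t <= h -> is_derive t 1 x (v t)) /\
  (forall t : R, 0 <= t <= h -> is_derive t 1 v (- grad f (x t))).

Lemma hamiltonian_flow_on (x0 v0 : 'rV[R]_d) (x : R -> 'rV[R]_d) :
  hamiltonian_solution f x0 v0 x -> flow_on x (derive1 x).
Proof.
case=> _ _ dx ddx; split=> t th //.
by rewrite derive1E; exact: derivableP.
Qed.

(** The factor on squares is [1 - z / 4] with [z = m2 * h ^+ 2], and
    [1 - z / 4 <= (1 - z / 8) ^+ 2]: this is the 8 of [hmc_theta]. *)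
Lemma flow_contraction (x v y w : R -> 'rV[R]_d) :
  flow_on x v -> flow_on y w -> v 0 = w 0 ->
  l2norm (x h - y h) <= (1 - hmc_theta m2 h) * l2norm (x 0 - y 0).
Proof.
move=> [xE vE] [yE wE] vw.
have m0 := wc_m2_gt0 wcf; have mM := wc_m2M2 wcf.
pose u t := x t - y t; pose g t := grad f (x t) - grad f (y t).
have [|P [P0 PE]] := @segment_antiderivative _ (fun t => dotv (g t) (u t)) h (ltW h0).
  move=> t th; apply: continuous_dotv; apply: is_derive_continuous.
    apply: is_derive_fctB; apply: (is_derive_gradcomp wcf); [exact: xE|exact: yE].
  by apply: is_derive_fctB; [exact: xE|exact: yE].
have := @second_order_contraction _ _ u (fun t => v t - w t) g P m2 M2 h m0 mM h0 Mh.
rewrite vw subrr => /(_ erefl) H.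
have {H} : dotv (u h) (u h) <= (1 - m2 * h ^+ 2 / 4) * dotv (u 0) (u 0).
  apply: H => //.
  - by move=> t th; apply: is_derive_fctB; [exact: xE|exact: yE].
  - move=> t th; rewrite /g opprB addrC -[grad f (y t)]opprK.
    by apply: is_derive_fctB; [exact: vE|exact: wE].
  - by move=> t th; exact: grad_mono wcf _ _.
  - by move=> t th; exact: grad_cocoercive wcf _ _.
have zle : m2 * h ^+ 2 <= 4^-1.
  by apply: le_trans Mh; rewrite ler_pM2r// exprn_gt0.
have z0 : 0 <= m2 * h ^+ 2 by rewrite mulr_ge0 ?sqr_ge0// ltW.
rewrite -!sqr_l2norm -/(u h) -/(u 0) /hmc_theta.
have := l2norm_ge0 (u 0); move: (m2 * h ^+ 2) zle z0 => z zle z0 b0 H.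
rewrite -ler_sqr ?nnegrE ?l2norm_ge0//; last by rewrite mulr_ge0//; lra.
apply: (le_trans H); rewrite exprMn ler_wpM2r ?sqr_ge0//.
by have := sqr_ge0 z; lra.
Qed.

(** The energy has zero derivative; the mean value inequality for it and for its opposite gives
    equality. *)
Lemma flow_energy (x v : R -> 'rV[R]_d) : flow_on x v ->
  f (x h) + dotv (v h) (v h) / 2 = f (x 0) + dotv (v 0) (v 0) / 2.
Proof.
move=> [xE vE].
pose H t := f (x t) + 2^-1 * dotv (v t) (v t).
have HE (t : R) : 0 <= t <= h -> is_derive t 1 H 0.
  move=> th; have := is_derive_fctD (is_derive_fcomp wcf (xE t th))
    (is_derive_fctMl 2^-1 (is_derive_dotv (vE t th) (vE t th))).
  move=> /is_derive_eq; apply.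
  by rewrite dotvNl dotvNr (dotvC (v t)); lra.
rewrite ![_ / 2]mulrC -/(H h) -/(H 0); apply/eqP; rewrite eq_le.
rewrite -subr_le0 -[X in _ && X]subr_le0.
have := MVT_le (ltW h0) HE (fun _ _ => lexx 0); rewrite mul0r => -> /=.
have := @MVT_le _ (fun t => - H t) (fun _ => - 0) 0 h 0 (ltW h0).
rewrite mul0r opprK addrC; apply; last by rewrite oppr0.
by move=> t th; apply: is_deriveN; exact: HE.
Qed.

(** * Existence of trajectories by Picard iteration *)

Section picard.
Variables (x0 v0 : 'rV[R]_d).

Lemma row_antiderivative (g : R -> 'rV[R]_d) :
  (forall t : R, 0 <= t <= h -> {for t, continuous g}) ->
  exists G : R -> 'rV[R]_d,
    G 0 = 0 /\ forall t : R, 0 <= t <= h -> is_derive t 1 G (g t).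
Proof.
move=> cg.
have H (i : 'I_d) : exists Gi : R -> R, Gi 0 = 0 /\
    forall t : R, 0 <= t <= h -> is_derive t 1 Gi (g t ord0 i).
  apply: segment_antiderivative (ltW h0) _ => t th.
  have cc : continuous (fun u : 'rV[R]_d => u ord0 i) by exact: coord_continuous.
  exact: (continuous_comp (cg t th) (cc _)).
have [G GE] := choice H; exists (fun t => \row_i G i t); split=> [|t th].
  by apply/rowP => i; rewrite !mxE; case: (GE i).
apply: is_derive_row => i; case: (GE i) => _ /(_ t th).
by congr (is_derive _ _ _ _); apply/funext => s; rewrite mxE.
Qed.

(** A Picard iteration encoded by initial values and derivatives, so that mean value inequalities
    apply to it. [y] is the current position curve, [p] the next position and velocity. *)
Let picard_step (y : R -> 'rV[R]_d) (p : (R -> 'rV[R]_d) * (R -> 'rV[R]_d)) :=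
  [/\ p.1 0 = x0, p.2 0 = v0,
    forall t : R, 0 <= t <= h -> is_derive t 1 p.1 (p.2 t) &
    forall t : R, 0 <= t <= h -> is_derive t 1 p.2 (- grad f (y t))].

Let picard_step_ex y : (forall t : R, 0 <= t <= h -> {for t, continuous y}) ->
  exists p, picard_step y p.
Proof.
move=> cy; have [|G [G0 GE]] := @row_antiderivative (fun t => - grad f (y t)).
  move=> t th; apply: cvgN; apply: (continuous_comp (cy t th)).
  exact: wc_continuous_grad wcf _.
have vE (t : R) : 0 <= t <= h ->
    is_derive t 1 (fun t => v0 + G t) (- grad f (y t)).
  move=> th; rewrite -[X in is_derive _ _ _ X]add0r.
  exact: (is_derive_fctD (is_derive_cst v0 t 1) (GE t th)).
have [|H [H0 HE]] := @row_antiderivative (fun t => v0 + G t).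
  by move=> t /vE; exact: is_derive_continuous.
exists (fun t => x0 + H t, fun t => v0 + G t); split => //=.
- by rewrite H0 addr0.
- by rewrite G0 addr0.
- move=> t th; rewrite -[X in is_derive _ _ _ X]add0r.
  exact: (is_derive_fctD (is_derive_cst x0 t 1) (HE t th)).
Qed.

(** The gradient costs a factor [M2] and each of the two integrations a factor [h]; the ratio
    [M2 * h ^+ 2] is at most [4^-1]. *)
Let picard_step_dist y p y' p' (B : R) : 0 <= B ->
  picard_step y p -> picard_step y' p' ->
  (forall t : R, 0 <= t <= h -> l2norm (y t - y' t) <= B) ->
  forall t : R, 0 <= t <= h -> l2norm (p.1 t - p'.1 t) <= B * 4^-1.
Proof.
move=> B0 [p10 p20 p1E p2E] [q10 q20 q1E q2E] yB.
have M0 := wc_M2_gt0 wcf.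
have MB : 0 <= M2 * B by rewrite mulr_ge0// ltW.
have vB (t : R) : 0 <= t <= h -> l2norm (p.2 t - p'.2 t) <= M2 * B * h.
  move=> /andP[t0 th].
  have := @MVT_l2norm _ _ (fun t => p.2 t - p'.2 t)
    (fun t => - grad f (y t) - - grad f (y' t)) 0 t (M2 * B) t0 MB.
  rewrite p20 q20 subrr !subr0 => H.
  apply: (@le_trans _ _ (M2 * B * t)); last by rewrite ler_wpM2l.
  apply: H => s /andP[s0 st].
    have sh : 0 <= s <= h by rewrite s0 (le_trans st).
    by apply: is_derive_fctB; [exact: p2E|exact: q2E].
  have sh : 0 <= s <= h by rewrite s0 (le_trans st).
  rewrite opprK addrC l2normBC -l2normN opprB l2normBC.
  apply: (le_trans (grad_lipschitz wcf _ _)).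
  by rewrite ler_pM2l// yB.
move=> t /andP[t0 th].
have MBh : 0 <= M2 * B * h by rewrite mulr_ge0// ltW.
have := @MVT_l2norm _ _ (fun t => p.1 t - p'.1 t)
  (fun t => p.2 t - p'.2 t) 0 t (M2 * B * h) t0 MBh.
rewrite p10 q10 subrr !subr0 => H.
apply: (@le_trans _ _ (M2 * B * h * t)).
  apply: H => s /andP[s0 st].
    have sh : 0 <= s <= h by rewrite s0 (le_trans st).
    by apply: is_derive_fctB; [exact: p1E|exact: q1E].
  by apply: vB; rewrite s0 (le_trans st).
apply: (@le_trans _ _ (M2 * B * h * h)); first by rewrite ler_wpM2l.
rewrite (_ : M2 * B * h * h = B * (M2 * h ^+ 2)); last by ring.
by rewrite ler_wpM2l.
Qed.

Lemma flow_exists : exists x v, [/\ flow_on x v, x 0 = x0 & v 0 = v0].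
Proof.
have H y : exists p : (R -> 'rV[R]_d) * (R -> 'rV[R]_d),
    (forall t : R, 0 <= t <= h -> {for t, continuous y}) -> picard_step y p.
  have [cy|ncy] := pselect (forall t : R, 0 <= t <= h -> {for t, continuous y}).
    by have [p pE] := picard_step_ex cy; exists p.
  (* A dummy value, so that the iteration is a total function and choice applies. *)
  by exists (cst 0, cst 0).
have {H}[S SE] := choice H.
pose x_ n := iter n (fun y => (S y).1) (cst x0).
have cx n (t : R) : 0 <= t <= h -> {for t, continuous (x_ n)}.
  elim: n t => [|n IH] t th; first exact: cst_continuous.
  case: (SE _ IH) => _ _ H _; exact: is_derive_continuous (H t th).
have xS n : picard_step (x_ n) (S (x_ n)) by exact/SE/cx.
have [B B0 xB] : exists2 B, 0 <= B &
    forall t : R, 0 <= t <= h -> l2norm (x_ 1%N t - x_ 0%N t) <= B.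
  have g1 : {within `[0, h], continuous (fun t => l2norm (x_ 1%N t - x_ 0%N t))}.
    apply: continuous_in_subspaceT => t; rewrite inE/= in_itv/= => th.
    apply: (@continuous_l2norm _ _ _ (fun t => x_ 1%N t - x_ 0%N t)).
    by apply: cvgB; exact: cx.
  have [c _ cmax] := EVT_max (ltW h0) g1.
  exists (l2norm (x_ 1%N c - x_ 0%N c)); first exact: l2norm_ge0.
  by move=> t th; apply: cmax; rewrite in_itv.
have xSB n (t : R) : 0 <= t <= h -> l2norm (x_ n.+1 t - x_ n t) <= B * 4^-1 ^+ n.
  elim: n t => [|n IH] t th; first by rewrite expr0 mulr1 xB.
  rewrite exprSr mulrA; apply: (picard_step_dist _ (xS n.+1) (xS n) IH) => //.
  by rewrite mulr_ge0// exprn_ge0// invr_ge0.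
have xmn n m (t : R) : 0 <= t <= h ->
    l2norm (x_ (n + m)%N t - x_ n t) <= 2 * B * 4^-1 ^+ n.
  move=> th.
  (* The factor [1 - 4^-1 ^+ m] makes the induction on the geometric sum close. *)
  suff : l2norm (x_ (n + m)%N t - x_ n t) <= 2 * B * 4^-1 ^+ n * (1 - 4^-1 ^+ m).
    move=> /le_trans; apply; apply: ler_piMr.
      by rewrite !mulr_ge0// exprn_ge0// invr_ge0.
    by rewrite gerBl exprn_ge0// invr_ge0.
  elim: m => [|m IH].
    by rewrite addn0 subrr l2norm0 expr0 subrr mulr0.
  rewrite addnS; apply: (le_trans (ler_l2norm_dist (x_ (n + m)%N t) _ _)).
  apply: (le_trans (lerD (xSB _ _ th) IH)).
  rewrite exprD [in leRHS]exprS.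
  have : 0 <= B * 4^-1 ^+ n * 4^-1 ^+ m :> R by rewrite !mulr_ge0// exprn_ge0// invr_ge0.
  by move: (4^-1 ^+ n : R) (4^-1 ^+ m : R) => a b; nra.
(* Clamping makes the limit a continuous function on the whole line. *)
pose y t := lim (x_ n (clamp h t) @[n --> \oo]).
have yB n (t : R) : l2norm (y t - x_ n (clamp h t)) <= 2 * B * 4^-1 ^+ n.
  set s := clamp h t; have sh : 0 <= s <= h by apply: clamp_itv; exact: ltW.
  have cvgx : cvgn (fun n => x_ n s).
    apply: cauchy_cvg; apply: cauchy_exP => e e0 /=.
    have [k ke] := geometric_small (2 * B) e0.
    exists (x_ k s); exists k => // m /= km.
    rewrite -ball_normE/= (le_lt_trans _ ke)//.
    apply: (le_trans (mx_norm_le_l2norm _)).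
    by rewrite l2normBC -(subnKC km) xmn.
  have cl : l2norm (x_ (n + m)%N s - x_ n s) @[m --> \oo] --> l2norm (y t - x_ n s).
    have c1 : (x_ (n + m)%N s - x_ n s) @[m --> \oo] --> y t - x_ n s.
      apply: cvgB; last exact: cvg_cst.
      under eq_fun do rewrite addnC.
      have H : (fun m => x_ m s) @ \oo --> y t by exact: cvgx.
      by move: H; rewrite -(cvg_shiftn n).
    apply: (cvg_comp _ _ c1).
    have c2 : {for (y t - x_ n s), continuous (fun u : 'rV[R]_d => l2norm u)}.
      exact: (@continuous_l2norm _ _ _ id).
    exact: c2.
  have := limr_le (cvgP _ cl); rewrite (cvg_lim _ cl)//; apply.
  by apply: nearW => m; exact: xmn.
have cy : continuous y.
  move=> t; apply/cvgrPdist_lt => e e0.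
  have e3 : 0 < e / 3 by rewrite divr_gt0.
  have [n ne] := geometric_small (2 * B) e3.
  have : {for t, continuous (fun s => x_ n (clamp h s))}.
    apply: (continuous_comp (@continuous_clamp _ h t)).
    by apply: cx; apply: clamp_itv; exact: ltW.
  move=> /cvgrPdist_lt/(_ _ e3); apply: filterS => s ts.
  rewrite (_ : y t - y s = (y t - x_ n (clamp h t)) +
    (x_ n (clamp h t) - x_ n (clamp h s)) - (y s - x_ n (clamp h s))); last first.
    by rewrite subrKA opprB subrKA.
  apply: (le_lt_trans (ler_normB _ _)).
  have H1 := le_lt_trans (le_trans (mx_norm_le_l2norm _) (yB n t)) ne.
  have H2 := le_lt_trans (le_trans (mx_norm_le_l2norm _) (yB n s)) ne.
  have := ler_normD (y t - x_ n (clamp h t)) (x_ n (clamp h t) - x_ n (clamp h s)).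
  by move: H1 H2 ts; lra.
have [p py] := picard_step_ex (fun t _ => cy t).
(* The limit is a fixed point: [p.1] and [y] are both within [2 * B * 4^-1 ^+ n.+1] of [x_ n.+1]. *)
have xy (t : R) : 0 <= t <= h -> p.1 t = y t.
  move=> th; apply/eqP; rewrite -subr_eq0; apply/eqP/l2norm_eq0.
  apply/eqP/negPn/negP => n0.
  have {}n0 : 0 < l2norm (p.1 t - y t) by rewrite lt_def n0 l2norm_ge0.
  have [n ne] := geometric_small (2 * B) n0.
  suff : l2norm (p.1 t - y t) <= 2 * B * 4^-1 ^+ n by rewrite leNgt ne.
  apply: (le_trans (ler_l2norm_dist (x_ n.+1 t) _ _)).
  have K : 0 <= 2 * B * 4^-1 ^+ n by rewrite !mulr_ge0// exprn_ge0// invr_ge0.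
  have H1 : l2norm (p.1 t - x_ n.+1 t) <= 2 * B * 4^-1 ^+ n * 4^-1.
    apply: (picard_step_dist K py (xS n) _ th) => s sh.
    by have := yB n s; rewrite clampK.
  have H2 := yB n.+1 t; rewrite clampK// exprSr in H2.
  by rewrite l2normBC in H2; move: H1 H2 K; rewrite mulrA; lra.
case: py => p10 p20 p1E p2E; exists p.1, p.2; split=> //; split=> // t th.
by rewrite xy//; exact: p2E.
Qed.

End picard.

End flow.

(** * Convergence of the symplectic Euler scheme to the flow *)

Section euler.
Context {R : realType} {d : nat}.
Variables (f : 'rV[R]_d -> R) (m2 M2 h : R).
Hypothesis wcf : well_conditioned f m2 M2.
Hypotheses (h0 : 0 < h) (Mh : M2 * h ^+ 2 <= 4^-1).

(* Symplectic Euler: a composition of two shears, hence volume preserving. *)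
Definition euler_step (tau : R) (z : 'rV[R]_d * 'rV[R]_d) :=
  (z.1 + tau *: z.2, z.2 - tau *: grad f (z.1 + tau *: z.2)).

Definition euler (n : nat) : 'rV[R]_d * 'rV[R]_d -> 'rV[R]_d * 'rV[R]_d :=
  iter n.+1 (euler_step (h / n.+1%:R)).

Definition flow_map (z : 'rV[R]_d * 'rV[R]_d) : 'rV[R]_d * 'rV[R]_d :=
  xget z [set q | exists x v,
    [/\ flow_on f h x v, x 0 = z.1, v 0 = z.2 & q = (x h, v h)]].

Lemma flow_mapP z : exists x v,
  [/\ flow_on f h x v, x 0 = z.1, v 0 = z.2 & flow_map z = (x h, v h)].
Proof.
rewrite /flow_map; case: xgetP => [q _ //|H].
have [x [v [xv x0 v0]]] := flow_exists wcf h0 Mh z.1 z.2.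
by exfalso; apply: (H (x h, v h)); exists x, v.
Qed.

Section convergence.
Variables (x v : R -> 'rV[R]_d).
Hypothesis xv : flow_on f h x v.

Let M0 : 0 < M2. Proof. exact: wc_M2_gt0 wcf. Qed.

Let segment_bound (g : R -> 'rV[R]_d) :
  (forall t : R, 0 <= t <= h -> {for t, continuous g}) ->
  exists2 B, 0 <= B & forall t : R, 0 <= t <= h -> l2norm (g t) <= B.
Proof.
move=> cg.
have cg' : {within `[0, h], continuous (fun t => l2norm (g t))}.
  apply: continuous_in_subspaceT => t; rewrite inE/= in_itv/= => th.
  by apply: (@continuous_l2norm _ _ _ g); exact: cg.
have [c _ cmax] := EVT_max (ltW h0) cg'.
exists (l2norm (g c)); first exact: l2norm_ge0.
by move=> t th; apply: cmax; rewrite in_itv.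
Qed.

(** Stability factor [1 + O(tau)] plus a local error [O(tau^2)]; [B1] bounds the velocity and [B2]
    the force along the exact trajectory. The term [M2 * h * B2] is the local position error fed
    into the force. *)
Let step_error (B1 B2 t tau : R) (z : 'rV[R]_d * 'rV[R]_d) :
  0 <= B1 -> 0 <= B2 ->
  (forall t : R, 0 <= t <= h -> l2norm (v t) <= B1) ->
  (forall t : R, 0 <= t <= h -> l2norm (grad f (x t)) <= B2) ->
  0 <= t -> 0 <= tau -> t + tau <= h ->
  l2norm ((euler_step tau z).1 - x (t + tau)) +
    l2norm ((euler_step tau z).2 - v (t + tau)) <=
  (1 + (1 + M2 + M2 * h) * tau) * (l2norm (z.1 - x t) + l2norm (z.2 - v t)) +
    (B2 + M2 * h * B2 + M2 * B1) * tau ^+ 2.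
Proof.
move=> B10 B20 vB gB t0 tau0 th; case: xv => xE vE.
have th' : t <= t + tau by rewrite lerDl.
have tauE : t + tau - t = tau by rewrite addrC addKr.
have in_h (s : R) : t <= s <= t + tau -> 0 <= s <= h.
  by move=> /andP[ts st]; rewrite (le_trans t0 ts) (le_trans st th).
have vt (s : R) : t <= s <= t + tau -> l2norm (v s - v t) <= B2 * tau.
  move=> /andP[ts st]; apply: (@le_trans _ _ (B2 * (s - t))).
    apply: (MVT_l2norm ts B20) => r /andP[tr rs]; have rh : 0 <= r <= h.
    - by apply: in_h; rewrite tr (le_trans rs).
    - exact: vE.
    - by apply: in_h; rewrite tr (le_trans rs).
    - by rewrite l2normN gB.
  by rewrite ler_wpM2l// lerBlDl.
have xt (s : R) : t <= s <= t + tau -> l2norm (x (t + tau) - x s) <= B1 * tau.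
  move=> /andP[ts st]; apply: (@le_trans _ _ (B1 * (t + tau - s))).
    apply: (MVT_l2norm st B10) => r /andP[sr rt]; have rh : 0 <= r <= h.
    - by apply: in_h; rewrite rt (le_trans ts).
    - exact: xE.
    - by apply: in_h; rewrite rt (le_trans ts).
    - by rewrite vB.
  by rewrite ler_wpM2l// lerBlDl lerD2r.
set x' := x (t + tau); set v' := v (t + tau); set z' := z.1 + tau *: z.2.
(* Subtracting the tangent line leaves a curve of derivative [v s - v t]. *)
have Hx : l2norm (x' - x t - tau *: v t) <= B2 * tau ^+ 2.
  have := @MVT_l2norm _ _ (fun s => x s - (0 + s *: v t)) (fun s => v s - v t)
    t (t + tau) (B2 * tau) th' (mulr_ge0 B20 tau0).
  rewrite tauE -mulrA -expr2 !add0r (_ : x' - x t - tau *: v t =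
    x (t + tau) - (t + tau) *: v t - (x t - t *: v t)); last first.
    by rewrite scalerDl !opprD !opprK /x'; apply/rowP => i; rewrite !mxE; ring.
  apply=> s sh.
    apply: is_derive_fctB; first by apply: xE; exact: in_h.
    exact: is_derive_line.
  exact: vt.
(* The force is frozen at the final position [x'], as the scheme evaluates it after moving. *)
have Hv : l2norm (v' - v t + tau *: grad f x') <= M2 * B1 * tau ^+ 2.
  have := @MVT_l2norm _ _ (fun s => v s + (0 + s *: grad f x'))
    (fun s => - grad f (x s) + grad f x')
    t (t + tau) (M2 * (B1 * tau)) th'.
  rewrite tauE !add0r (_ : v' - v t + tau *: grad f x' =
    v (t + tau) + (t + tau) *: grad f x' - (v t + t *: grad f x')); last first.
    by rewrite scalerDl !opprD /v'; apply/rowP => i; rewrite !mxE; ring.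
  rewrite (_ : M2 * (B1 * tau) * tau = M2 * B1 * tau ^+ 2); last by ring.
  apply=> [|s sh|s sh]; first by rewrite !mulr_ge0// ltW.
    apply: is_derive_fctD; first by apply: vE; exact: in_h.
    exact: is_derive_line.
  rewrite addrC; apply: (le_trans (grad_lipschitz wcf _ _)).
  by rewrite ler_pM2l// xt.
rewrite /= -/z'.
have Ha : l2norm (z' - x') <= l2norm (z.1 - x t) + tau * l2norm (z.2 - v t) + B2 * tau ^+ 2.
  rewrite (_ : z' - x' = (z.1 - x t) + tau *: (z.2 - v t) - (x' - x t - tau *: v t)); last first.
    by apply/rowP => i; rewrite !mxE; ring.
  apply: (le_trans (ler_l2normB _ _)); rewrite lerD//.
  apply: (le_trans (ler_l2normD _ _)); rewrite lerD//.
  by rewrite l2normZ ger0_norm.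
have Hb : l2norm (z.2 - tau *: grad f z' - v') <=
    l2norm (z.2 - v t) + tau * (M2 * l2norm (z' - x')) + M2 * B1 * tau ^+ 2.
  rewrite (_ : z.2 - tau *: grad f z' - v' = (z.2 - v t) -
    tau *: (grad f z' - grad f x') - (v' - v t + tau *: grad f x')); last first.
    by apply/rowP => i; rewrite !mxE; ring.
  apply: (le_trans (ler_l2normB _ _)); rewrite lerD//.
  apply: (le_trans (ler_l2normB _ _)); rewrite lerD//.
  by rewrite l2normZ ger0_norm// ler_wpM2l// (grad_lipschitz wcf).
have := l2norm_ge0 (z.1 - x t); have := l2norm_ge0 (z.2 - v t).
move: Ha Hb; move: (l2norm (z' - x')) (l2norm (z.2 - _ - _)) (l2norm (z.1 - _))
  (l2norm (z.2 - v t)) => a' b' a b Ha Hb b0 a0.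
have tauh : tau <= h by apply: le_trans th; rewrite lerDr.
have Ha' := ler_wpM2l (mulr_ge0 tau0 (ltW M0)) Ha.
have K1 : 0 <= M2 * h * tau * a by rewrite !mulr_ge0// ltW.
have K2 : M2 * tau * b * tau <= M2 * tau * b * h by rewrite ler_wpM2l// !mulr_ge0// ltW.
have K3 : M2 * tau ^+ 2 * B2 * tau <= M2 * tau ^+ 2 * B2 * h.
  by rewrite ler_wpM2l// !mulr_ge0// ?exprn_ge0// ltW.
have K4 : 0 <= M2 * tau * b by rewrite !mulr_ge0// ltW.
have K5 : 0 <= tau * a by rewrite mulr_ge0.
nra.
Qed.

(** Discrete Gronwall: after [k] steps the error is at most [k K tau^2 (1 + L tau)^k]. At [k = n.+1]
    the power is at most [expR (L * h)] and [k tau^2 = h^2 / n.+1]. *)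
Lemma euler_error : exists2 C, 0 <= C & forall n,
  l2norm ((euler n (x 0, v 0)).1 - x h) + l2norm ((euler n (x 0, v 0)).2 - v h)
    <= C / n.+1%:R.
Proof.
case: (xv) => xE vE.
have [B1 B10 vB] := segment_bound (fun t th => is_derive_continuous (vE t th)).
have [|B2 B20 gB] := @segment_bound (fun t => grad f (x t)).
  by move=> t th; exact: is_derive_continuous (is_derive_gradcomp wcf (xE t th)).
set L := 1 + M2 + M2 * h; set K := B2 + M2 * h * B2 + M2 * B1.
have L0 : 0 <= L by rewrite !addr_ge0// ?mulr_ge0// ltW.
have K0 : 0 <= K by rewrite !addr_ge0// ?mulr_ge0// ?mulr_ge0// ltW.
exists (h ^+ 2 * K * expR (L * h)).
  by rewrite !mulr_ge0// ?exprn_ge0// ?expR_ge0// ltW.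
move=> n; set tau := h / n.+1%:R.
have tau0 : 0 <= tau by rewrite divr_ge0// ltW.
have nt : n.+1%:R * tau = h by rewrite /tau mulrC divfK.
have Lt1 : 1 <= 1 + L * tau by rewrite lerDl mulr_ge0.
pose z k := iter k (euler_step tau) (x 0, v 0).
have H k : (k <= n.+1)%N ->
    l2norm ((z k).1 - x (k%:R * tau)) + l2norm ((z k).2 - v (k%:R * tau)) <=
    k%:R * K * tau ^+ 2 * (1 + L * tau) ^+ k.
  elim: k => [|k IH] kn; first by rewrite !mul0r/= !subrr !l2norm0 addr0.
  have kt : k%:R * tau + tau = k.+1%:R * tau.
    by rewrite -[k.+1%:R]natr1 mulrDl mul1r.
  have kh : k%:R * tau + tau <= h by rewrite kt -nt ler_wpM2r// ler_nat.
  have := step_error (z k) B10 B20 vB gB (mulr_ge0 (ler0n R k) tau0) tau0 kh.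
  rewrite kt => /le_trans; apply.
  have := ler_wpM2l (le_trans ler01 Lt1) (IH (ltnW kn)).
  rewrite -/L -/K => H1; apply: (le_trans (lerD H1 (lexx _))).
  rewrite -[k.+1%:R]natr1 [_ ^+ k.+1]exprSr.
  have : K * tau ^+ 2 * 1 <= K * tau ^+ 2 * ((1 + L * tau) ^+ k * (1 + L * tau)).
    apply: ler_wpM2l; first by rewrite mulr_ge0// exprn_ge0.
    by rewrite -exprSr exprn_ege1.
  move: (1 + L * tau) ((1 + L * tau) ^+ k) (k%:R : R) (tau ^+ 2) => a b c e; lra.
have := H n.+1 (leqnn _); rewrite nt => /le_trans; apply.
rewrite (_ : h ^+ 2 * K * expR (L * h) / n.+1%:R =
  n.+1%:R * K * tau ^+ 2 * expR (L * h)); last first.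
  have : (n.+1%:R : R) != 0 by rewrite pnatr_eq0.
  by rewrite /tau; move: (n.+1%:R : R) => N N0; field.
apply: ler_wpM2l; first exact: (mulr_ge0 (mulr_ge0 (ler0n _ _) K0) (exprn_ge0 2 tau0)).
have -> : L * h = n.+1%:R * (L * tau) by rewrite mulrCA nt.
rewrite expRM_natl lerXn2r ?nnegrE ?expR_ge0 ?(le_trans ler01 Lt1)//.
exact: expR_ge1Dx.
Qed.

End convergence.

(** The constant of the error bound depends on the trajectory, so the convergence is pointwise, as
    Fatou's lemma requires. *)
Lemma euler_cvg z : (euler n z).1 @[n --> \oo] --> (flow_map z).1 /\
  (euler n z).2 @[n --> \oo] --> (flow_map z).2.
Proof.
have [x [v [xv x0 v0 ->]]] := flow_mapP z; have [C C0 HC] := euler_error xv.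
have z0 : (x 0, v 0) = z by rewrite x0 v0; case: (z).
rewrite z0 in HC.
have c0 : C / n.+1%:R @[n --> \oo] --> 0.
  rewrite -(mulr0 C); apply: cvgMr; exact: cvg_harmonic.
by split; apply: l2norm_cvg0; apply: squeeze_cvgr (cvg_cst 0) c0; apply: nearW => n;
  rewrite l2norm_ge0 (le_trans _ (HC n))// ?lerDl ?lerDr l2norm_ge0.
Qed.

Lemma flow_map_energy z :
  f (flow_map z).1 + dotv (flow_map z).2 (flow_map z).2 / 2 =
  f z.1 + dotv z.2 z.2 / 2.
Proof.
have [x [v [xv <- <- ->]]] := flow_mapP z.
exact: flow_energy wcf h0 _ _ xv.
Qed.

End euler.

(** * Lebesgue and Gaussian measures on row vectors *)

Section density.
Local Open Scope ereal_scope.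
Context (dT : measure_display) (T : measurableType dT) (R : realType).
Variables (mu nu : {measure set T -> \bar R}) (p : T -> R).
Hypotheses (mp : measurable_fun setT p) (p0 : forall x, (0 <= p x)%R).
Hypothesis nuE : forall A, measurable A -> nu A = \int[mu]_(x in A) (p x)%:E.

Import HBNNSimple.

Let mpE : measurable_fun setT (fun x => (p x)%:E).
Proof. exact/measurable_EFinP. Qed.

Let nnsfun_density (g : {nnsfun T >-> R}) :
  \int[nu]_x (g x)%:E = \int[mu]_x ((g x)%:E * (p x)%:E).
Proof.
have mgk k : measurable (g @^-1` [set k]) by [].
under eq_integral do rewrite fimfunE -fsumEFin//.
rewrite ge0_integral_fsum//; last 2 first.
- by move=> k; exact/measurable_EFinP/measurable_funM.
- by move=> k x _; rewrite nnfun_muleindic_ge0.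
transitivity (\int[mu]_x (\sum_(k \in range g)
    ((k * \1_(g @^-1` [set k]) x)%:E * (p x)%:E))).
  rewrite ge0_integral_fsum//; last 2 first.
  - move=> k; apply: emeasurable_funM => //.
    by apply/measurable_EFinP/measurable_funM.
  - move=> k x _; apply: mule_ge0; last by rewrite lee_fin.
    by rewrite nnfun_muleindic_ge0.
  apply: eq_fsbigr => k kg.
  rewrite integralZl_indic_nnsfun// integral_indic// setIT nuE// [in LHS]integral_mkcond.
  have k0 : (0 <= k)%R by move: kg; rewrite inE => -[x _ <-].
  rewrite -ge0_integralZl//.
  - apply: eq_integral => x _; rewrite patchE indicE.
    by case: ifPn; rewrite ?mulr1 ?mulr0 ?mule0 ?mul0e.
  - by apply/(measurable_restrictT _ _).1 => //; exact: measurable_funS mpE.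
  - by move=> x _; rewrite patchE; case: ifPn; rewrite ?lee_fin.
apply: eq_integral => x _; rewrite [in RHS]fimfunE -fsumEFin//.
rewrite ge0_mule_fsuml// => k.
by rewrite nnfun_muleindic_ge0.
Qed.

(** Simple functions and monotone convergence, from a density known only through its integrals over
    sets. *)
Lemma ge0_integral_density (g : T -> \bar R) : measurable_fun setT g ->
  (forall x, 0 <= g x) -> \int[nu]_x g x = \int[mu]_x (g x * (p x)%:E).
Proof.
move=> mg g0; pose g_ := nnsfun_approx measurableT mg.
have cg x : (g_ n x)%:E @[n --> \oo] --> g x by exact: cvg_nnsfun_approx.
have ndg x : {homo (fun n => (g_ n x)%:E) : n m / (n <= m)%N >-> n <= m}.
  by move=> m n mn; rewrite lee_fin; exact/lefP/nd_nnsfun_approx.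
transitivity (limn (fun n => \int[nu]_x (g_ n x)%:E)).
  rewrite -monotone_convergence//.
  - by apply: eq_integral => x _; apply/esym/cvg_lim.
  - by move=> n; exact/measurable_EFinP.
  - by move=> n x _; rewrite lee_fin.
rewrite (_ : (fun n => _) = fun n => \int[mu]_x ((g_ n x)%:E * (p x)%:E)); last first.
  by apply/funext => n; exact: nnsfun_density.
rewrite -monotone_convergence//.
- apply: eq_integral => x _; apply/cvg_lim => //; apply: cvgeZr => //.
- by move=> n; apply: emeasurable_funM => //; exact/measurable_EFinP.
- by move=> n x _; rewrite mule_ge0// lee_fin.
- by move=> x _ m n mn; rewrite lee_wpmul2r ?lee_fin//; exact: ndg.
Qed.

End density.

Section rV_measurability.
Context {R : realType} {d : nat}.

Lemma cons_rV0 (p : measurableTypeR R * 'rV[R]_d) : cons_rV p ord0 ord0 = p.1.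
Proof.
rewrite /cons_rV mxE; case: fintype.splitP => [j _|k //].
by rewrite (ord1 j) mxE eqxx.
Qed.

Lemma cons_rVS (p : measurableTypeR R * 'rV[R]_d) j :
  cons_rV p ord0 (lift ord0 j) = p.2 ord0 j.
Proof.
rewrite /cons_rV mxE; case: fintype.splitP => [k|k] /=; first by rewrite (ord1 k).
by rewrite /bump/= => -[/val_inj ->].
Qed.

Definition rV_head (x : 'rV[R]_d.+1) : measurableTypeR R := x ord0 ord0.

Definition rV_tail (x : 'rV[R]_d.+1) : 'rV[R]_d := \row_j x ord0 (lift ord0 j).

Lemma cons_rV_head p : rV_head (@cons_rV R d p) = p.1.
Proof. exact: cons_rV0. Qed.

Lemma cons_rV_tail p : rV_tail (@cons_rV R d p) = p.2.
Proof. by apply/rowP => j; rewrite mxE cons_rVS. Qed.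

Lemma measurable_rV_head : measurable_fun setT rV_head.
Proof. exact: measurable_coor. Qed.

Lemma measurable_rV_tail : measurable_fun setT rV_tail.
Proof.
apply: measurable_fun_rVP => j.
rewrite (_ : (fun t => _) = fun x : 'rV[R]_d.+1 => x ord0 (lift ord0 j)).
  exact: measurable_coor.
by apply/funext => x; rewrite mxE.
Qed.

End rV_measurability.

(** * Tonelli for powers of a measure *)

Section power_measure_sigma_finite.
Context {R : realType}.
Variable mu : {sigma_finite_measure set (measurableTypeR R) -> \bar R}.

(** Both exhaustions are increasing, so the products at equal index cover the space. *)
Lemma power_measure_sigma_finite d : sigma_finite setT (power_measure mu d).
Proof.
elim: d => [|d IH].
  apply: fin_num_fun_sigma_finite; first by rewrite measure0.
  move=> A mA; exact: fin_num_measure.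
have /sigma_finiteP[F [TF ndF Foo]] := sigma_finiteT mu.
have /sigma_finiteP[G [TG ndG Goo]] := IH.
exists (fun n => @rV_head R d @^-1` F n `&` @rV_tail R d @^-1` G n).
  apply/seteqP; split=> // x _.
  have [n _ Fx] : (\bigcup_i F i) (rV_head x) by rewrite -TF.
  have [m _ Gx] : (\bigcup_i G i) (rV_tail x) by rewrite -TG.
  exists (maxn n m) => //; split => /=.
  - by move: Fx; exact/subsetPset/ndF/leq_maxl.
  - by move: Gx; exact/subsetPset/ndG/leq_maxr.
move=> n; have [mF Fn] := Foo n; have [mG Gn] := Goo n; split.
  by apply: measurableI; rewrite -[X in measurable X]setTI;
    [exact: measurable_rV_head|exact: measurable_rV_tail].
rewrite /= /cons_measure /pushforward.
rewrite [X in ((_ \x^ _) X)%E](_ : _ = F n `*` G n); last first.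
  by apply/seteqP; split=> p /=; rewrite cons_rV_head cons_rV_tail.
by rewrite product_measure2E// lte_mul_pinfty// ge0_fin_numE.
Qed.

(** A separate name for [power_measure], to which the sigma-finite structure used by Tonelli is
    attached. *)
Definition pow_measure d : set 'rV[R]_d -> \bar R := power_measure mu d.

Arguments pow_measure d _ : clear implicits.

HB.instance Definition _ d := Measure.on (pow_measure d).

HB.instance Definition _ d := Measure_isSigmaFinite.Build _ _ _
  (pow_measure d) (power_measure_sigma_finite d).

Local Open Scope ereal_scope.

Lemma integral_pow_measure0 (g : 'rV[R]_0 -> \bar R) :
  measurable_fun setT g -> \int[pow_measure 0]_x g x = g (0 : 'rV[R]_0)%R.
Proof. by move=> mg; rewrite integral_dirac// diracT mul1e. Qed.

Lemma integral_pow_measureS d (g : 'rV[R]_d.+1 -> \bar R) :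
  measurable_fun setT g -> (forall x, 0 <= g x) ->
  \int[pow_measure d.+1]_x g x =
  \int[pow_measure d]_x \int[mu]_t g (cons_rV (t, x)).
Proof.
move=> mg g0.
have mc := @measurable_cons_rV R d.
have mgc : measurable_fun setT (g \o @cons_rV R d) by exact: measurableT_comp.
transitivity (\int[(mu \x pow_measure d)]_p (g \o @cons_rV R d) p).
  transitivity (\int[(mu \x^ pow_measure d)]_p (g \o @cons_rV R d) p).
    by rewrite [LHS](ge0_integral_pushforward mc).
  (* [cons_measure] is built on the product [\x^]; it agrees with [\x] on rectangles, hence
     everywhere. *)
  apply: eq_measure_integral => A mA _; apply/esym.
  by apply: product_measure_unique => // B C mB mC; exact: product_measure2E.
exact: (fubini_tonelli2 (g \o @cons_rV R d) mgc (fun=> g0 _)).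
Qed.

End power_measure_sigma_finite.
Arguments pow_measure {R} mu d _.

(** * Affine changes of variables *)

Section affine_substitution.
Context {R : realType}.
Variable s : R.
Hypothesis s0 : (0 < s)%R.
Local Open Scope ereal_scope.

Let affine (b : R) (t : measurableTypeR R) : measurableTypeR R := (s * t + b)%R.

Let maffine b : measurable_fun setT (affine b).
Proof.
apply: (@measurable_funD _ _ _ _ (fun t : measurableTypeR R => (s * t)%R) (cst b)) => //.
by apply: measurable_funM.
Qed.

Let pushforward_affine b : exists pf : {measure set (measurableTypeR R) -> \bar R},
  (pf : set _ -> \bar R) = pushforward (@lebesgue_measure R) (affine b).
Proof.
by unshelve eexists (pushforward (@lebesgue_measure R) (affine b));
  [exact: maffine|].
Qed.

(** The push-forward of Lebesgue measure by [affine b], scaled by [s], gives half-open intervals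
    their length, so it is Lebesgue measure by uniqueness. *)
Let integral_lebesgue_affine b (g : measurableTypeR R -> \bar R) :
  measurable_fun setT g -> (forall x, 0 <= g x) ->
  \int[lebesgue_measure]_t g (affine b t) =
  (s^-1)%:E * \int[lebesgue_measure]_t g t.
Proof.
move=> mg g0; have [pf pfE] := pushforward_affine b.
have lebE : forall A, measurable A -> lebesgue_measure A = mscale (NngNum (ltW s0)) pf A.
  apply: lebesgue_measure_unique => X [[x y] _ <-] /=.
  rewrite /mscale /= pfE /pushforward.
  have -> : affine b @^-1` `]x, y] = `]((x - b) / s)%R, ((y - b) / s)%R]%classic.
    apply/seteqP; split=> t /=; rewrite !in_itv/= /affine => /andP[xt ty].
      by rewrite ltr_pdivrMr// ler_pdivlMr// mulrC ltrBlDr lerBrDr xt ty.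
    by move: xt ty; rewrite ltr_pdivrMr// ler_pdivlMr// mulrC ltrBlDr lerBrDr => -> ->.
  rewrite !lebesgue_measure_itv/= !lte_fin ltr_pM2r ?invr_gt0// ltrD2r.
  case: ifPn => xy; last by rewrite mule0.
  by rewrite -!EFinB -EFinM; congr EFin; field; exact: lt0r_neq0.
rewrite [in RHS](eq_measure_integral (mscale (NngNum (ltW s0)) pf)); last first.
  by move=> A mA _; exact: lebE.
rewrite ge0_integral_mscale// muleA -EFinM mulVf ?lt0r_neq0// mul1e pfE.
by rewrite (ge0_integral_pushforward (maffine b)).
Qed.

Definition leb d : set 'rV[R]_d -> \bar R := pow_measure (@lebesgue_measure R) d.

Arguments leb d _ : clear implicits.

HB.instance Definition _ d := SigmaFiniteMeasure.on (leb d).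

Lemma measurable_affine_rV d (b : 'rV[R]_d) :
  measurable_fun setT (fun x : 'rV[R]_d => s *: x + b)%R.
Proof.
apply: measurable_fun_rVP => i.
rewrite (_ : (fun t => _) = fun x : 'rV[R]_d => (s * x ord0 i + b ord0 i)%R).
  apply: measurable_funD => //; apply: measurable_funM => //.
  exact: measurable_coor.
by apply/funext => x; rewrite !mxE.
Qed.

(** One coordinate at a time by Tonelli. Translations serve the shears, scalings the second
    moment. *)
Lemma integral_leb_affine d (b : 'rV[R]_d) (g : 'rV[R]_d -> \bar R) :
  measurable_fun setT g -> (forall x, 0 <= g x) ->
  \int[leb d]_x g (s *: x + b)%R = (s^-1 ^+ d)%:E * \int[leb d]_x g x.
Proof.
elim: d b g => [|d IH] b g mg g0.
  have mgs := measurableT_comp mg (measurable_affine_rV b).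
  rewrite !integral_pow_measure0// expr0 mul1e; congr g.
  by apply/rowP => -[].
have mgs := measurableT_comp mg (measurable_affine_rV b).
have mgc : measurable_fun setT (g \o @cons_rV R d).
  exact: (measurableT_comp mg (@measurable_cons_rV R d)).
rewrite !integral_pow_measureS//=.
have mG := measurable_fun_fubini_tonelli_G (m1 := @lebesgue_measure R) _ mgc (fun=> g0 _).
transitivity (\int[leb d]_x ((s^-1)%:E *
    \int[lebesgue_measure]_t g (cons_rV (t, (s *: x + rV_tail b)%R)))).
  apply: eq_integral => x _.
  rewrite -(integral_lebesgue_affine (rV_head b))//; last first.
    exact: (measurableT_comp mgc (measurable_pair2 _)).
  apply: eq_integral => t _; congr g.
  apply/rowP => j; rewrite [LHS]mxE [X in (X + _)%R]mxE.
  case: (unliftP ord0 j) => [k|] ->.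
    by rewrite !cons_rVS/= !mxE.
  by rewrite !cons_rV0.
rewrite ge0_integralZl//; last 3 first.
- exact: (measurableT_comp mG (measurable_affine_rV _)).
- by move=> x _; apply: integral_ge0.
- by rewrite lee_fin invr_ge0 ltW.
rewrite (IH (rV_tail b) (fun x => \int[lebesgue_measure]_t g (cons_rV (t, x))))//.
- by rewrite muleA -EFinM exprS.
- by move=> x; apply: integral_ge0.
Qed.

End affine_substitution.
Arguments leb {R} d _.

Section measurable_rV_operations.
Context (dT : measure_display) (T : measurableType dT) (R : realType) (d : nat).
Implicit Types f g : T -> 'rV[R]_d.

Lemma measurable_fun_coor f i : measurable_fun setT f ->
  measurable_fun setT (fun t => f t ord0 i).
Proof. by move=> mf; exact: (measurableT_comp (@measurable_coor R d i) mf). Qed.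

Lemma measurable_fun_rVD f g : measurable_fun setT f -> measurable_fun setT g ->
  measurable_fun setT (fun t => f t + g t).
Proof.
move=> mf mg; apply: measurable_fun_rVP => i; under eq_fun do rewrite mxE.
by apply: measurable_funD; exact: measurable_fun_coor.
Qed.

Lemma measurable_fun_rVZ (a : R) f : measurable_fun setT f ->
  measurable_fun setT (fun t => a *: f t).
Proof.
move=> mf; apply: measurable_fun_rVP => i; under eq_fun do rewrite mxE.
by apply: measurable_funM => //; exact: measurable_fun_coor.
Qed.

Lemma measurable_fun_rVB f g : measurable_fun setT f -> measurable_fun setT g ->
  measurable_fun setT (fun t => f t - g t).
Proof.
move=> mf mg; apply: measurable_fun_rVP => i; under eq_fun do rewrite !mxE.
by apply: measurable_funB; exact: measurable_fun_coor.
Qed.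

Lemma measurable_fun_dotv f g : measurable_fun setT f -> measurable_fun setT g ->
  measurable_fun setT (fun t => dotv (f t) (g t)).
Proof.
move=> mf mg; apply: measurable_sum => i.
by apply: measurable_funM; exact: measurable_fun_coor.
Qed.

End measurable_rV_operations.

(** * Continuous functions and the sigma-algebra generated by the coordinates *)

Section continuous_measurable.
Context {R : realType} {d : nat}.

Let grid (n : nat) (x : 'rV[R]_d) : 'rV[R]_d :=
  \row_i ((Num.floor (n.+1%:R * x ord0 i))%:~R / n.+1%:R).

Let grid_cvg x : grid n x @[n --> \oo] --> x.
Proof.
apply/cvgrPdist_le => e e0.
have : harmonic n @[n --> \oo] --> (0 : R) by exact: cvg_harmonic.
move=> /cvgrPdist_le/(_ _ e0); apply: filterS => n; rewrite sub0r normrN => ne.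
rewrite [leLHS]/Num.Def.normr/= mx_normrE; apply: bigmax_le => [|i _]; first exact: ltW.
rewrite !mxE (ord1 i.1); apply: le_trans ne.
set N : R := n.+1%:R; have N0 : 0 < N by rewrite ltr0n.
rewrite [leRHS]ger0_norm ?invr_ge0 ?ler0n// /harmonic -/N.
set t := x ord0 i.2.
have /andP[h1 h2] := floor_itv (N * t); rewrite intrD1 in h2.
rewrite ler_norml; apply/andP; split.
  rewrite -(ler_pM2r N0) mulrBl divfK ?lt0r_neq0// mulNr mulVf ?lt0r_neq0//.
  by rewrite (mulrC t); lra.
rewrite -(ler_pM2r N0) mulrBl divfK ?lt0r_neq0// mulVf ?lt0r_neq0//.
by rewrite (mulrC t); lra.
Qed.

(** An arbitrary [g] is allowed, because [grid n] takes countably many values, each on a measurable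
    cell. *)
Let measurable_grid n (g : 'rV[R]_d -> R) : measurable_fun setT (g \o grid n).
Proof.
move=> _ Y mY; rewrite setTI.
(* [C z] is the cell of index [z]; [D z] is everything or nothing. *)
pose C (z : 'rV[int]_d) : set 'rV[R]_d :=
  \bigcap_(i in [set: 'I_d]) [set x | Num.floor (n.+1%:R * x ord0 i) = z ord0 i].
pose D (z : 'rV[int]_d) : set 'rV[R]_d :=
  [set x | Y (g (\row_i ((z ord0 i)%:~R / n.+1%:R)))].
rewrite [X in measurable X](_ : _ = \bigcup_z (C z `&` D z)); last first.
  apply/seteqP; split=> x /=.
    move=> Yx; exists (\row_i Num.floor (n.+1%:R * x ord0 i)) => //; split.
      by move=> i _ /=; rewrite mxE.
    rewrite /D/=; move: Yx; rewrite /grid.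
    by congr (Y (g _)); apply/rowP => i; rewrite !mxE.
  move=> [z _ [Cz Dz]]; move: Dz; rewrite /D/=.
  by congr (Y (g _)); apply/rowP => i; rewrite !mxE (Cz i).
apply: countable_bigcupT_measurable => [|z].
  exact: countableP.
apply: measurableI.
  apply: fin_bigcap_measurable => [|i _]; first exact: finite_finset.
  rewrite [X in measurable X](_ : _ = (fun x : 'rV[R]_d => x ord0 i) @^-1`
    `[((z ord0 i)%:~R / n.+1%:R), ((z ord0 i + 1)%:~R / n.+1%:R)[%classic).
    by rewrite -[X in measurable X]setTI; exact: (@measurable_coor R d i).
  apply/seteqP; split=> x /=; rewrite in_itv/=.
    move=> <-; have /andP[h1 h2] := floor_itv (n.+1%:R * x ord0 i).
    by rewrite ler_pdivrMr ?ltr0n// ltr_pdivlMr ?ltr0n// (mulrC (x ord0 i)) h1 h2.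
  rewrite ler_pdivrMr ?ltr0n// ltr_pdivlMr ?ltr0n// (mulrC (x ord0 i)) => h.
  exact: floor_def.
rewrite /D; have [H|H] := pselect (Y (g (\row_i ((z ord0 i)%:~R / n.+1%:R)))).
  by rewrite [X in measurable X](_ : _ = setT)//; apply/seteqP; split.
by rewrite [X in measurable X](_ : _ = set0)//; apply/seteqP; split.
Qed.

(** [g] is the pointwise limit of [g \o grid n]. *)
Lemma continuous_measurable_rV (g : 'rV[R]_d -> R) : continuous g ->
  measurable_fun setT g.
Proof.
move=> cg; apply: (@measurable_fun_cvg _ _ _ _ (fun n => g \o grid n)).
  by move=> n; exact: measurable_grid.
move=> x _; have H := @cvg_comp _ _ _ (grid^~ x) g _ _ _ (@grid_cvg x) (cg x).
exact: H.
Qed.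

End continuous_measurable.

(** * Density of the standard Gaussian measure *)

Section gauss_density.
Context {R : realType}.
Local Open Scope ereal_scope.

Definition gauss_pdf d (v : 'rV[R]_d) : R :=
  (normal_peak 1 ^+ d * expR (- (dotv v v / 2)))%R.

Lemma gauss_pdf_ge0 d (v : 'rV[R]_d) : (0 <= gauss_pdf v)%R.
Proof. by rewrite mulr_ge0 ?exprn_ge0 ?normal_peak_ge0 ?expR_ge0. Qed.

Lemma measurable_gauss_pdf d : measurable_fun setT (@gauss_pdf d).
Proof.
apply: measurable_funM => //; apply: measurableT_comp => //.
apply: measurableT_comp => //; apply: measurable_funM => //.
exact: (@measurable_fun_dotv _ _ _ _ id id).
Qed.

Let measurable_gauss_pdfE d :
  measurable_fun setT (fun x : 'rV[R]_d => (gauss_pdf x)%:E).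
Proof. apply/measurable_EFinP; exact: measurable_gauss_pdf. Qed.

Lemma gauss_pdf_cons d (t : measurableTypeR R) (x : 'rV[R]_d) :
  gauss_pdf (cons_rV (t, x)) = (normal_pdf 0 1 (t : R) * gauss_pdf x)%R.
Proof.
rewrite /gauss_pdf normal_pdfE ?oner_neq0//= /normal_fun.
rewrite {1}/dotv big_ord_recl cons_rV0/=.
under eq_bigr do rewrite cons_rVS/=.
rewrite -/(dotv x x) subr0 expr1n exprS -!mulrA; congr *%R.
rewrite [RHS]mulrCA; congr *%R; rewrite -expRD; congr expR.
by rewrite expr2; field.
Qed.

Let pdf1_ge0 (t : R) : (0 <= normal_pdf 0 1 t)%R. Proof. exact: normal_pdf_ge0. Qed.

(** Induction on [d]: the one-dimensional density acts on the first coordinate, the induction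
    hypothesis on the others, and the densities multiply. *)
Lemma integral_gauss d (g : 'rV[R]_d -> \bar R) :
  measurable_fun setT g -> (forall x, 0 <= g x) ->
  \int[gauss_rV R d]_x g x = \int[leb d]_x (g x * (gauss_pdf x)%:E).
Proof.
rewrite -[gauss_rV R d : set _ -> \bar R]/(pow_measure (normal_prob (0 : R) 1) d).
elim: d g => [|d IH] g mg g0.
  rewrite !integral_pow_measure0//; last first.
    exact: (emeasurable_funM mg (@measurable_gauss_pdfE 0)).
  by rewrite /gauss_pdf expr0 /dotv big_ord0 mul0r oppr0 expR0 mulr1 mule1.
have mgc : measurable_fun setT (g \o @cons_rV R d).
  exact: (measurableT_comp mg (@measurable_cons_rV R d)).
have mpd : measurable_fun setT (fun x : 'rV[R]_d.+1 => g x * (gauss_pdf x)%:E).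
  exact: (emeasurable_funM mg (@measurable_gauss_pdfE d.+1)).
rewrite !integral_pow_measureS//; last first.
  by move=> x; rewrite mule_ge0// lee_fin gauss_pdf_ge0.
have mp1 : measurable_fun setT (fun p : measurableTypeR R * 'rV[R]_d =>
    (normal_pdf 0 1 (p.1 : R))%:E).
  apply/measurable_EFinP.
  exact: (measurableT_comp (measurable_normal_pdf 0 1) measurable_fst).
have mgp : measurable_fun setT (fun p : measurableTypeR R * 'rV[R]_d =>
    g (cons_rV p) * (normal_pdf 0 1 (p.1 : R))%:E).
  exact: (emeasurable_funM mgc mp1).
have gp0 p : 0 <= g (cons_rV p) * (normal_pdf 0 1 (p.1 : R))%:E.
  by rewrite mule_ge0// lee_fin.
have mG := measurable_fun_fubini_tonelli_G (m1 := @lebesgue_measure R) _ mgp gp0.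
have sec (x : 'rV[R]_d) : measurable_fun setT
    (fun t : measurableTypeR R => g (cons_rV (t, x))).
  exact: (measurableT_comp mgc (measurable_pair2 x)).
transitivity (\int[pow_measure (normal_prob (0 : R) 1) d]_x
    \int[lebesgue_measure]_t (g (cons_rV (t, x)) * (normal_pdf 0 1 (t : R))%:E)).
  apply: eq_integral => x _.
  exact: (@ge0_integral_density _ (measurableTypeR R) R (@lebesgue_measure R)
    (normal_prob (0 : R) 1) (normal_pdf 0 1) (measurable_normal_pdf 0 1) pdf1_ge0
    (fun A _ => erefl) _ (sec x) (fun=> g0 _)).
rewrite IH//; last by move=> x; apply: integral_ge0 => t _; exact: (gp0 (t, x)).
apply: eq_integral => x _; rewrite -ge0_integralZr//.
- by apply: eq_integral => t _; rewrite gauss_pdf_cons [in RHS]EFinM muleA.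
- exact: (measurableT_comp mgp (measurable_pair2 x)).
- by rewrite lee_fin gauss_pdf_ge0.
Qed.

End gauss_density.

(** * Volume preservation by the Euler scheme *)

Section euler_volume.
Context {R : realType} {d : nat}.
Variables (f : 'rV[R]_d -> R) (m2 M2 : R).
Hypothesis wcf : well_conditioned f m2 M2.
Local Open Scope ereal_scope.

Lemma measurable_grad : measurable_fun setT (grad f).
Proof.
apply: measurable_fun_rVP => i; apply: continuous_measurable_rV => x.
have cc : continuous (fun u : 'rV[R]_d => u ord0 i) by exact: coord_continuous.
exact: (continuous_comp (wc_continuous_grad wcf (x := x)) (cc _)).
Qed.

Lemma integral_leb_translation (b : 'rV[R]_d) (g : 'rV[R]_d -> \bar R) :
  measurable_fun setT g -> (forall x, 0 <= g x) ->
  \int[leb d]_x g (x + b)%R = \int[leb d]_x g x.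
Proof.
move=> mg g0; have := integral_leb_affine (@ltr01 R) b mg g0.
rewrite invr1 expr1n mul1e => <-; apply: eq_integral => x _.
by rewrite scale1r.
Qed.

Let drift (tau : R) (z : 'rV[R]_d * 'rV[R]_d) := (z.1 + tau *: z.2, z.2)%R.

Let kick (tau : R) (z : 'rV[R]_d * 'rV[R]_d) := (z.1, z.2 - tau *: grad f z.1)%R.

Let measurable_drift tau : measurable_fun setT (drift tau).
Proof.
apply/measurable_fun_pairP; split => /=; last exact: measurable_snd.
apply: measurable_fun_rVD; first exact: measurable_fst.
by apply: measurable_fun_rVZ; exact: measurable_snd.
Qed.

Let measurable_kick tau : measurable_fun setT (kick tau).
Proof.
apply/measurable_fun_pairP; split => /=; first exact: measurable_fst.
apply: measurable_fun_rVB; first exact: measurable_snd.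
apply: measurable_fun_rVZ.
exact: (measurableT_comp measurable_grad measurable_fst).
Qed.

Lemma measurable_euler_step tau : measurable_fun setT (euler_step f tau).
Proof. exact: (measurableT_comp (measurable_kick tau) (measurable_drift tau)). Qed.

Let measurable_iter_step tau k : measurable_fun setT (iter k (euler_step f tau)).
Proof.
elim: k => [|k IH]; first exact: measurable_id.
have -> : iter k.+1 (euler_step f tau) = euler_step f tau \o iter k (euler_step f tau) by [].
exact: (measurableT_comp (measurable_euler_step tau) IH).
Qed.

Lemma measurable_euler h n : measurable_fun setT (euler f h n).
Proof. exact: measurable_iter_step. Qed.

Implicit Type g : 'rV[R]_d * 'rV[R]_d -> \bar R.

(** At fixed velocity the drift is a translation: integrate over positions first. The kick is
    treated with the roles exchanged. *)
Let integral_drift tau g : measurable_fun setT g -> (forall z, 0 <= g z) ->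
  \int[leb d \x leb d]_z (g \o drift tau) z = \int[leb d \x leb d]_z g z.
Proof.
move=> mg g0.
have mgd : measurable_fun setT (g \o drift tau).
  exact: (measurableT_comp mg (measurable_drift tau)).
rewrite [LHS](fubini_tonelli2 _ mgd (fun=> g0 _)) [RHS](fubini_tonelli2 _ mg g0).
apply: eq_integral => v _.
apply: (@integral_leb_translation (tau *: v)%R (fun x => g (x, v))) => //.
exact: (measurableT_comp mg (measurable_pair2 v)).
Qed.

Let integral_kick tau g : measurable_fun setT g -> (forall z, 0 <= g z) ->
  \int[leb d \x leb d]_z (g \o kick tau) z = \int[leb d \x leb d]_z g z.
Proof.
move=> mg g0.
have mgd : measurable_fun setT (g \o kick tau).
  exact: (measurableT_comp mg (measurable_kick tau)).
rewrite [LHS](fubini_tonelli1 _ mgd (fun=> g0 _)) [RHS](fubini_tonelli1 _ mg g0).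
apply: eq_integral => x _.
apply: (@integral_leb_translation (- (tau *: grad f x))%R (fun v => g (x, v))) => //.
exact: (measurableT_comp mg (measurable_pair1 x)).
Qed.

Lemma integral_euler h n g : measurable_fun setT g -> (forall z, 0 <= g z) ->
  \int[leb d \x leb d]_z (g \o euler f h n) z = \int[leb d \x leb d]_z g z.
Proof.
(* The step length depends on [n]; it is generalized before the induction on the number of steps. *)
rewrite /euler; move: (h / _)%R => tau; elim: n.+1 g => // k IH g mg g0.
have mgk : measurable_fun setT (g \o kick tau).
  exact: (measurableT_comp mg (measurable_kick tau)).
have mgs : measurable_fun setT (g \o euler_step f tau).
  exact: (measurableT_comp mg (measurable_euler_step tau)).
rewrite -[RHS](integral_kick tau mg g0) -[RHS](integral_drift tau mgk (fun=> g0 _)).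
exact: (IH _ mgs (fun=> g0 _)).
Qed.

End euler_volume.

(** * Invariance of the target *)

Section orthants.
Context {R : realType} {d : nat}.

Definition orthant_o (a : 'rV[R]_d) : set 'rV[R]_d :=
  [set x | forall i, x ord0 i < a ord0 i].

Definition orthant_c (a : 'rV[R]_d) : set 'rV[R]_d :=
  [set x | forall i, x ord0 i <= a ord0 i].

Let measurable_coor_itv i (I : interval R) :
  measurable [set x : 'rV[R]_d | x ord0 i \in I].
Proof.
rewrite -[X in measurable X]setTI.
exact: (@measurable_coor R d i measurableT [set` I] (measurable_itv I)).
Qed.

Lemma measurable_orthant_o a : measurable (orthant_o a).
Proof.
rewrite (_ : orthant_o a = \bigcap_(i in [set: 'I_d])
    [set x | x ord0 i \in `]-oo, a ord0 i[]); last first.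
  apply/seteqP; split=> x /= H i; first by move=> _ /=; rewrite in_itv/=.
  by have := H i I; rewrite /= in_itv.
by apply: fin_bigcap_measurable => // i _; exact: measurable_coor_itv.
Qed.

Lemma measurable_orthant_c a : measurable (orthant_c a).
Proof.
rewrite (_ : orthant_c a = \bigcap_(i in [set: 'I_d])
    [set x | x ord0 i \in `]-oo, a ord0 i]]); last first.
  apply/seteqP; split=> x /= H i; first by move=> _ /=; rewrite in_itv/=.
  by have := H i I; rewrite /= in_itv.
by apply: fin_bigcap_measurable => // i _; exact: measurable_coor_itv.
Qed.

Let orthants : set (set 'rV[R]_d) := [set orthant_o a | a in setT].

Let exists_nat_gt (x : 'rV[R]_d) : exists n : nat, forall i, x ord0 i < n%:R.
Proof.
exists (Num.truncn `|x|).+1 => i; apply: (le_lt_trans (ler_norm _)).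
apply: (le_lt_trans _ (truncnS_gt _)).
rewrite [leRHS]/Num.Def.normr/= mx_normrE.
exact: (le_bigmax _ (fun i => `|x i.1 i.2|) (ord0, i)).
Qed.

Let measurable_orthantsE : (measurable : set (set 'rV[R]_d)) = <<s orthants >>.
Proof.
apply/seteqP; split; last first.
  apply: smallest_sub; first exact: sigma_algebra_measurable.
  by move=> _ [a _ <-]; exact: measurable_orthant_o.
pose S := g_sigma_algebraType orthants.
suff mid : measurable_fun setT (fun x : S => (x : 'rV[R]_d)).
  by move=> A mA; have := mid measurableT A mA; rewrite setTI.
apply: measurable_fun_rVP => i.
apply: (measurability (@RGenInftyO.G R)); first exact: RGenInftyO.measurableE.
move=> _ [_ [r ->] <-]; rewrite setTI.
(* A half-space in coordinate [i] is the union of orthants whose other bounds tend to infinity. *)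
pose a (n : nat) : 'rV[R]_d := \row_j (if j == i then r else n%:R).
rewrite [X in measurable X](_ : _ = \bigcup_n orthant_o (a n)); last first.
  apply/seteqP; split=> x /=; rewrite in_itv/=.
    move=> xr; have [n xn] := exists_nat_gt x; exists n => // j.
    by rewrite mxE; case: eqVneq => [->|_].
  by move=> [n _ /(_ i)]; rewrite mxE eqxx.
apply: bigcupT_measurable => n; apply: sub_sigma_algebra.
by exists (a n).
Qed.

(** Open orthants are stable under intersection, generate the sigma-algebra and exhaust the
    space. *)
Lemma measure_rV_unique (mu nu : {measure set 'rV[R]_d -> \bar R}) :
  (mu setT < +oo)%E -> (forall a, mu (orthant_o a) = nu (orthant_o a)) ->
  forall A, measurable A -> mu A = nu A.
Proof.
move=> muoo munu A mA.
apply: (measure_unique orthants (fun n => orthant_o (const_mx n%:R))) => //.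
- move=> _ _ [a _ <-] [b _ <-]; exists (\row_i Num.min (a ord0 i) (b ord0 i)) => //.
  apply/seteqP; split=> x /=.
    by move=> H; split=> i; have := H i; rewrite mxE lt_min => /andP[].
  by move=> [Ha Hb] i; rewrite mxE lt_min Ha Hb.
- by move=> n; exists (const_mx n%:R).
- apply/seteqP; split=> // x _; have [n xn] := exists_nat_gt x.
  by exists n => // i; rewrite mxE.
- by move=> _ [a _ <-]; exact: munu.
- move=> n; apply: le_lt_trans muoo; apply: le_measure; rewrite ?inE//.
  exact: measurable_orthant_o.
Qed.

(** Openness in sequential form, as it is tested along the Euler approximations of one
    trajectory. *)
Definition seq_open (U : set 'rV[R]_d) := forall (x : 'rV[R]_d) (x_ : nat -> 'rV[R]_d),
  x_ @ \oo --> x -> U x -> \forall n \near \oo, U (x_ n).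

Let cvg_coor (x : 'rV[R]_d) (x_ : nat -> 'rV[R]_d) i :
  x_ @ \oo --> x -> x_ n ord0 i @[n --> \oo] --> x ord0 i.
Proof.
move=> cx.
have cc : continuous (fun u : 'rV[R]_d => u ord0 i) by exact: coord_continuous.
exact: (@cvg_comp _ _ _ x_ (fun u : 'rV[R]_d => u ord0 i) _ _ _ cx (cc x)).
Qed.

Lemma seq_open_orthant_o a : seq_open (orthant_o a).
Proof.
move=> x x_ cx xa; apply: filter_forall => i.
by apply: (cvgr_lt _ (@cvg_coor x x_ i cx)); exact: xa.
Qed.

Lemma seq_open_orthant_cC a : seq_open (~` orthant_c a).
Proof.
move=> x x_ cx /existsNP[i /negP]; rewrite -ltNge => ax.
have : \forall n \near \oo, a ord0 i < x_ n ord0 i.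
  by apply: (cvgr_gt _ (@cvg_coor x x_ i cx)).
apply: filterS => n an.
by apply/existsNP; exists i; apply/negP; rewrite -ltNge.
Qed.

(** Lets a bound on closed orthants pass to open ones by continuity from below. *)
Lemma orthant_oE (a : 'rV[R]_d) :
  orthant_o a = \bigcup_n orthant_c (\row_i (a ord0 i - n.+1%:R^-1)).
Proof.
apply/seteqP; split=> x /= xa; last first.
  case: xa => n _ xn i; have := xn i; rewrite mxE => /le_lt_trans; apply.
  by rewrite gtrBl invr_gt0.
have : \forall n \near \oo, forall i, x ord0 i <= a ord0 i - n.+1%:R^-1.
  apply: filter_forall => i.
  have e0 : 0 < a ord0 i - x ord0 i by rewrite subr_gt0.
  have /cvgrPdist_le/(_ _ e0) := @cvg_harmonic R; apply: filterS => n.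
  rewrite sub0r normrN ger0_norm ?invr_ge0//= /harmonic => h.
  by rewrite lerBrDr addrC -lerBrDr.
case=> n _ /(_ n (leqnn n)) xn; exists n => // i; rewrite mxE; exact: xn.
Qed.

(* Portmanteau: open sets from above, closed ones from below. *)
Lemma probability_rV_le (mu nu : probability 'rV[R]_d R) :
  (forall U, measurable U -> seq_open U -> (nu U <= mu U)%E) ->
  forall A, measurable A -> nu A = mu A.
Proof.
move=> H; have Hc a : (mu (orthant_c a) <= nu (orthant_c a))%E.
  have mc := measurable_orthant_c a.
  have := H _ (measurableC mc) (seq_open_orthant_cC (a := a)).
  rewrite !probability_setC//.
  rewrite -(fineK (fin_num_measure mu _ mc)) -(fineK (fin_num_measure nu _ mc)).
  by rewrite -!EFinB !lee_fin; lra.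
suff Ho a : nu (orthant_o a) = mu (orthant_o a).
  have nuoo : (nu setT < +oo)%E by rewrite probability_setT ltry.
  exact: (@measure_rV_unique nu mu nuoo Ho).
apply/eqP; rewrite eq_le; apply/andP; split.
  exact: H (measurable_orthant_o a) (seq_open_orthant_o (a := a)).
rewrite [in leLHS]orthant_oE.
have mF n := measurable_orthant_c (\row_i (a ord0 i - n.+1%:R^-1)).
have ndF : {homo (fun n => orthant_c (\row_i (a ord0 i - n.+1%:R^-1))) :
    n m / (n <= m)%N >-> (n <= m)%O}.
  move=> n m nm; apply/subsetPset => x xn i; rewrite mxE; have := xn i; rewrite mxE.
  move=> /le_trans; apply; rewrite lerD2l lerN2 lef_pV2 ?posrE// ler_nat.
  by rewrite ltnS.
have cmu := nondecreasing_cvg_mu (mu := mu) mF (bigcupT_measurable _ mF) ndF.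
rewrite -(cvg_lim _ cmu)//; apply: lime_le; first by apply: cvgP cmu.
apply: nearW => n; apply: (le_trans (Hc _)); rewrite orthant_oE.
apply: le_measure; rewrite ?inE//; first exact: bigcupT_measurable.
by move=> x xn; exists n.
Qed.

End orthants.

(** * The flow followed by projection on positions preserves the target *)

Section invariance.
Context {R : realType} {d : nat}.
Variables (f : 'rV[R]_d -> R) (m2 M2 h : R).
Hypothesis wcf : well_conditioned f m2 M2.
Hypotheses (h0 : (0 < h)%R) (Mh : (M2 * h ^+ 2 <= 4^-1)%R).
Local Open Scope ereal_scope.

Lemma measurable_flow_map1 :
  measurable_fun setT (fun z : 'rV[R]_d * 'rV[R]_d => (flow_map f h z).1).
Proof.
apply: measurable_fun_rVP => i.
apply: (@measurable_fun_cvg _ _ _ _ (fun n z => (euler f h n z).1 ord0 i)).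
  move=> n; apply: measurable_fun_coor.
  exact: (measurableT_comp measurable_fst (measurable_euler wcf h n)).
move=> z _; have [cz _] := euler_cvg wcf h0 Mh z.
have cc : continuous (fun u : 'rV[R]_d => u ord0 i) by exact: coord_continuous.
exact: (@cvg_comp _ _ _ (fun n => (euler f h n z).1) (fun u : 'rV[R]_d => u ord0 i)
  _ _ _ cz (cc _)).
Qed.

(** The density of target times Gaussian, up to a constant: a function of the energy. *)
Let E (z : 'rV[R]_d * 'rV[R]_d) : R := expR (- (f z.1 + dotv z.2 z.2 / 2)).

Let measurable_E : measurable_fun setT E.
Proof.
apply: measurableT_comp => //; apply: measurableT_comp => //.
apply: measurable_funD.
  apply: (measurableT_comp _ measurable_fst).
  by apply: continuous_measurable_rV; exact: wc_continuous wcf.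
apply: measurable_funM => //.
by apply: measurable_fun_dotv; exact: measurable_snd.
Qed.

Let E_ge0 z : (0 <= E z)%R. Proof. exact: expR_ge0. Qed.

(** The limit is the weight at the end of the exact flow, which conservation of energy identifies
    with the weight at [z]. *)
Let E_euler_cvg z : E (euler f h n z) @[n --> \oo] --> E z.
Proof.
have [c1 c2] := euler_cvg wcf h0 Mh z.
have -> : E z = E (flow_map f h z) by rewrite /E (flow_map_energy wcf h0 Mh).
have cH : (f (euler f h n z).1 + dotv (euler f h n z).2 (euler f h n z).2 / 2)%R
    @[n --> \oo] --> (f (flow_map f h z).1 +
      dotv (flow_map f h z).2 (flow_map f h z).2 / 2)%R.
  apply: cvgD.
    have cf := wc_continuous wcf (x := (flow_map f h z).1).
    exact: (@cvg_comp _ _ _ (fun n => (euler f h n z).1) f _ _ _ c1 cf).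
  apply: cvgM; last exact: cvg_cst.
  have cd : {for (flow_map f h z).2, continuous (fun u : 'rV[R]_d => dotv u u)}.
    by apply: (@continuous_dotv R d 'rV[R]_d id id); exact: cvg_id.
  exact: (@cvg_comp _ _ _ (fun n => (euler f h n z).2)
    (fun u : 'rV[R]_d => dotv u u) _ _ _ c2 cd).
exact: (@cvg_comp _ _ _ _ (@expR R) _ _ _ (cvgN cH) (@continuous_expR R _)).
Qed.

(** If the flow from [z] ends in [U], its Euler approximations are eventually in [U], so the
    integrands converge to [E z]; by volume preservation all their integrals are equal. *)
Let flow_fatou (U : set 'rV[R]_d) : measurable U -> seq_open U ->
  \int[leb d \x leb d]_(z in [set z | U (flow_map f h z).1]) (E z)%:E <=
  \int[leb d \x leb d]_z ((\1_U z.1)%:E * (E z)%:E).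
Proof.
move=> mU oU; set D := [set z | _].
have mD : measurable D.
  by rewrite -[D]setTI; exact: (measurable_flow_map1 measurableT mU).
pose g z : \bar R := (\1_U z.1)%:E * (E z)%:E.
have mg : measurable_fun setT g.
  apply: emeasurable_funM; apply/measurable_EFinP => //.
  by apply: (measurableT_comp _ measurable_fst); exact: measurable_indic.
have g0 z : 0 <= g z by rewrite mule_ge0// lee_fin.
pose g_ n z := g (euler f h n z).
have mg_ n : measurable_fun setT (g_ n).
  exact: (measurableT_comp mg (measurable_euler wcf h n)).
have gE n : \int[leb d \x leb d]_z g_ n z = \int[leb d \x leb d]_z g z.
  exact: (integral_euler wcf).
have -> : \int[leb d \x leb d]_(z in D) (E z)%:E =
    \int[leb d \x leb d]_(z in D) limn_einf (g_^~ z).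
  apply: eq_integral => z /[!inE] Dz.
  suff c : g_ n z @[n --> \oo] --> (E z)%:E by rewrite (cvg_limn_einf_sup c).1.
  have [c1 _] := euler_cvg wcf h0 Mh z.
  apply: (@cvg_trans _ ((E (euler f h n z))%:E @[n --> \oo])).
    apply: near_eq_cvg; have := oU _ _ c1 Dz.
    by apply: filterS => n Un; rewrite /g_ /g indicE mem_set// mul1e.
  apply: cvg_EFin; first exact: nearW.
  exact: (@E_euler_cvg z).
have mgD n : measurable_fun D (g_ n) by exact: measurable_funTS.
apply: (le_trans (fatou (leb d \x leb d) mD mgD (fun n z _ => g0 _))).
rewrite limn_einf_lim; apply: lime_le; first exact: is_cvg_einfs.
apply: nearW => n; apply: (@le_trans _ _ (\int[leb d \x leb d]_(z in D) g_ n z)).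
  by apply: ereal_inf_lbound; exists n => /=.
rewrite -(gE n); apply: ge0_subset_integral => //.
by move=> z _; exact: g0.
Qed.

Variables (mu nu : probability 'rV[R]_d R) (c : R).
Hypotheses (c0 : (0 < c)%R)
  (muE : forall A, measurable A -> mu A = \int[lebesgue_rV R d]_(x in A) (c * expR (- f x))%:E)
  (nuE : forall A, measurable A -> nu A = gauss_rV R d A).

Let K : R := (c * normal_peak 1 ^+ d)%R.

Let K_ge0 : (0 <= K)%R.
Proof. by rewrite mulr_ge0 ?exprn_ge0 ?normal_peak_ge0// ltW. Qed.

Let measurable_ef : measurable_fun setT (fun x => c * expR (- f x))%R.
Proof.
apply: measurable_funM => //; apply: measurableT_comp => //.
apply: measurableT_comp => //.
by apply: continuous_measurable_rV; exact: wc_continuous wcf.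
Qed.

Lemma ge0_integral_target (g : 'rV[R]_d -> \bar R) : measurable_fun setT g ->
  (forall x, 0 <= g x) ->
  \int[mu]_x g x = \int[leb d]_x (g x * (c * expR (- f x))%:E).
Proof.
move=> mg g0; apply: ge0_integral_density => //.
by move=> x; rewrite mulr_ge0 ?expR_ge0// ltW.
Qed.

(** [K] gathers the normalizing constants of both factors. *)
Let phase_density W : measurable W ->
  (mu \x nu) W = K%:E * \int[leb d \x leb d]_z ((\1_W z)%:E * (E z)%:E).
Proof.
move=> mW; have m1 : measurable_fun setT (fun z => (\1_W z : R)%:E).
  by apply/measurable_EFinP; exact: measurable_indic.
have mE : measurable_fun setT (fun z => (\1_W z)%:E * (E z)%:E).
  by apply: emeasurable_funM => //; exact/measurable_EFinP.
have E0 z : 0 <= (\1_W z)%:E * (E z)%:E by rewrite mule_ge0// lee_fin.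
have mp1 (x : 'rV[R]_d) : measurable_fun setT (fun v => (\1_W (x, v) : R)%:E).
  exact: (measurableT_comp m1 (measurable_pair1 x)).
have mpdf : measurable_fun setT (fun z : 'rV[R]_d * 'rV[R]_d => (gauss_pdf z.2)%:E).
  apply/measurable_EFinP.
  exact: (measurableT_comp (@measurable_gauss_pdf R d) measurable_snd).
have mG : measurable_fun setT (fun z => (\1_W z)%:E * (gauss_pdf z.2)%:E).
  exact: (emeasurable_funM m1 mpdf).
have G0 z : 0 <= (\1_W z)%:E * (gauss_pdf z.2)%:E.
  by rewrite mule_ge0// lee_fin ?gauss_pdf_ge0.
have mF := measurable_fun_fubini_tonelli_F (m2 := leb d) _ mG G0.
have -> : (mu \x nu) W = \int[mu \x nu]_z (\1_W z)%:E by rewrite integral_indic// setIT.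
rewrite (fubini_tonelli1 _ m1) => [|z]; last by rewrite lee_fin.
transitivity (\int[mu]_x fubini_F (leb d) (fun z => (\1_W z)%:E * (gauss_pdf z.2)%:E) x).
  apply: eq_integral => x _.
  rewrite /fubini_F [LHS](eq_measure_integral (gauss_rV R d)); last by move=> A mA _; exact: nuE.
  by rewrite integral_gauss// => v; rewrite lee_fin.
rewrite ge0_integral_target//; last first.
  by move=> x; apply: integral_ge0 => v _; exact: (G0 (x, v)).
rewrite -ge0_integralZl// (fubini_tonelli1 (fun z => K%:E * ((\1_W z)%:E * (E z)%:E))); last 2 first.
- exact: emeasurable_funM.
- by move=> z; rewrite mule_ge0// lee_fin.
apply: eq_integral => x _; rewrite /fubini_F -ge0_integralZr//.
- apply: eq_integral => v _ /=; rewrite /E /K /gauss_pdf/= opprD expRD.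
  rewrite -muleA [RHS]muleCA; congr *%E; rewrite -!EFinM; congr EFin; ring.
- exact: (measurableT_comp mG (measurable_pair1 x)).
- by rewrite lee_fin mulr_ge0 ?expR_ge0// ltW.
Qed.

Lemma flow_map_invariant A : measurable A ->
  (mu \x nu) [set z | A (flow_map f h z).1] = mu A.
Proof.
pose ms := isMeasurableFun.Build _ _ _ _ _ measurable_flow_map1.
pose phi : {mfun ('rV[R]_d * 'rV[R]_d)%type >-> 'rV[R]_d} :=
  HB.pack (fun z => (flow_map f h z).1) ms.
move=> mA; apply: (@probability_rV_le _ _ mu (distribution (mu \x nu) phi)) => //.
move=> U mU oU.
have mW : measurable [set z | U (flow_map f h z).1].
  by rewrite -[X in measurable X]setTI; exact: (measurable_flow_map1 measurableT mU).
(* Seen as a cylinder in phase space, [U] also has its mass expressed with [E]. *)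
have -> : mu U = (mu \x nu) (U `*` setT).
  by rewrite product_measure1E// [X in _ * X]probability_setT mule1.
rewrite /distribution /pushforward.
rewrite [X in X <= _](phase_density mW) phase_density; last exact: measurableX.
apply: lee_wpmul2l; first by rewrite lee_fin.
have -> : \int[leb d \x leb d]_z ((\1_[set z | U (flow_map f h z).1] z)%:E * (E z)%:E) =
    \int[leb d \x leb d]_(z in [set z | U (flow_map f h z).1]) (E z)%:E.
  rewrite [RHS]integral_mkcond; apply: eq_integral => z _.
  by rewrite patchE indicE; case: ifPn; rewrite ?mul1e ?mul0e.
apply: (le_trans (flow_fatou mU oU)); rewrite le_eqVlt; apply/orP; left; apply/eqP.
apply: eq_integral => z _; congr (_%:E * _); rewrite !indicE; congr (_%:R).
congr nat_of_bool; apply/idP/idP; rewrite !inE/=; [by []|by case].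
Qed.

End invariance.

(** * Second moment of the target about the starting point *)

Section second_moment.
Context {R : realType} {d : nat}.
Variables (f : 'rV[R]_d -> R) (m2 M2 : R).
Hypothesis wcf : well_conditioned f m2 M2.
Variable x0 : 'rV[R]_d.

Let m0 : 0 < m2. Proof. exact: wc_m2_gt0 wcf. Qed.

(** Along the segment from [x0] to [x], the slope at any time [t >= s] is at least
    [<grad f x0, w> + m2 s |w|^2], with [w = x - x0]. *)
Lemma f_line_diff (s : R) (x : 'rV[R]_d) : 0 <= s <= 1 ->
  (1 - s) * (dotv (grad f x0) (x - x0) + m2 * s * dotv (x - x0) (x - x0)) <=
  f x - f (s *: x + (1 - s) *: x0).
Proof.
move=> /andP[s0 s1]; set w := x - x0.
have -> : s *: x + (1 - s) *: x0 = x0 + s *: w.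
  by apply/rowP => i; rewrite !mxE; ring.
have -> : f x = f (x0 + 1 *: w) by rewrite scale1r /w addrC subrK.
have := @MVT_le _ (fun t => - f (x0 + t *: w))
  (fun t => - dotv (grad f (x0 + t *: w)) w) s 1
  (- (dotv (grad f x0) w + m2 * s * dotv w w)) s1.
rewrite opprK => H; rewrite -lerN2 opprB addrC (mulrC (1 - s)) -mulNr; apply: H.
  move=> t _; apply: is_deriveN; apply: (is_derive_fcomp wcf).
  exact: is_derive_line.
move=> t /andP[st t1]; rewrite lerN2.
have := grad_line_mono wcf x0 w (le_trans s0 (ltW st)).
rewrite scale0r addr0 subr0 => H1.
have H2 : m2 * dotv w w * s <= m2 * dotv w w * t.
  by rewrite ler_wpM2l ?(ltW st)// mulr_ge0 ?dotvv_ge0// ltW.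
by move: H1 H2; lra.
Qed.

(** Use [1 + t <= expR t] at [t = f x - f y]. Young's inequality absorbs the linear term of
    [f_line_diff] at the cost of [m2 / 2 |w|^2], whence [s - 2^-1]. *)
Let density_le (s : R) (x : 'rV[R]_d) : 0 <= s <= 1 ->
  expR (- f x) * (1 + (1 - s) * (m2 * (s - 2^-1)) * dotv (x - x0) (x - x0)) <=
  expR (- f (s *: x + (1 - s) *: x0)) +
  expR (- f x) * ((1 - s) * (dotv (grad f x0) (grad f x0) / (2 * m2))).
Proof.
move=> s01; have /andP[s0 s1] := s01.
have := f_line_diff x s01; set w := x - x0; set y := s *: x + (1 - s) *: x0 => H; clearbody w.
have Hy : expR (- f x) * (1 + (f x - f y)) <= expR (- f y).
  rewrite [leRHS](_ : _ = expR (- f x + (f x - f y))); last by congr expR; ring.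
  by rewrite expRD ler_pM2l ?expR_gt0// expR_ge1Dx.
have Hg : - (dotv (grad f x0) (grad f x0) / (2 * m2)) - m2 / 2 * dotv w w <=
    dotv (grad f x0) w.
  have := dotvv_ge0 (grad f x0 + m2 *: w).
  rewrite dotvDl !dotvDr !dotvZl !dotvZr (dotvC w (grad f x0)).
  move: (dotv (grad f x0) (grad f x0)) (dotv (grad f x0) w) (dotv w w) => gg gw ww h.
  have t0 : 0 < 2 * m2 by rewrite mulr_gt0.
  have ggE : gg / (2 * m2) * (2 * m2) = gg by rewrite divfK// gt_eqF.
  move: (gg / (2 * m2)) ggE => a aE.
  suff : (- a - m2 / 2 * ww) * (2 * m2) <= gw * (2 * m2) by rewrite ler_pM2r.
  by lra.
have H1 := ler_wpM2l (_ : 0 <= 1 - s) Hg; rewrite subr_ge0 in H1.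
have {}H1 := H1 s1.
rewrite -lerBlDr -mulrBr; apply: le_trans Hy.
rewrite ler_pM2l ?expR_gt0//.
by move: H H1; move: (dotv _ _ / _) (dotv (grad f x0) w) (dotv w w) (f x - f y) => a b e k; lra.
Qed.

Variables (mu : probability 'rV[R]_d R) (c : R).
Hypotheses (c0 : 0 < c)
  (muE : forall A, measurable A ->
    mu A = (\int[lebesgue_rV R d]_(x in A) (c * expR (- f x))%:E)%E).
Local Open Scope ereal_scope.

Let measurable_f : measurable_fun setT f.
Proof. by apply: continuous_measurable_rV; exact: wc_continuous wcf. Qed.

Let measurable_ef : measurable_fun setT (fun x => c * expR (- f x))%R.
Proof.
apply: measurable_funM => //; apply: measurableT_comp => //.
exact: measurableT_comp.
Qed.

Let measurable_r2 : measurable_fun setT (fun x : 'rV[R]_d => dotv (x - x0) (x - x0)).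
Proof.
have mB : measurable_fun setT (fun x : 'rV[R]_d => x - x0)%R.
  by apply: measurable_fun_rVB; [exact: measurable_id|exact: measurable_cst].
exact: measurable_fun_dotv.
Qed.

Let ef_ge0 x : (0 <= c * expR (- f x))%R.
Proof. by rewrite mulr_ge0 ?expR_ge0// ltW. Qed.

(* Comparing the masses of [exp (- f)] and of its dilation of ratio [s] centred
   at [x0] replaces an integration by parts. *)
Let dilation_bound (s : R) : (2^-1 <= s < 1)%R ->
  1 + ((1 - s) * (m2 * (s - 2^-1)))%:E *
    \int[mu]_x (dotv (x - x0) (x - x0))%:E <=
  (s^-1 ^+ d + (1 - s) * (dotv (grad f x0) (grad f x0) / (2 * m2)))%:E.
Proof.
move=> /andP[s2 s1]; have s0 : (0 < s)%R by apply: lt_le_trans s2.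
set a := ((1 - s) * (m2 * (s - 2^-1)))%R; set B := ((1 - s) * (_ / _))%R.
have a0 : (0 <= a)%R.
  by rewrite !mulr_ge0 ?subr_ge0// ?(ltW s1)// ltW.
have B0 : (0 <= B)%R.
  rewrite mulr_ge0 ?subr_ge0 ?(ltW s1)// divr_ge0 ?dotvv_ge0//.
  by rewrite mulr_ge0// ltW.
pose r2 (x : 'rV[R]_d) := dotv (x - x0) (x - x0).
have mr : measurable_fun setT (fun x => (r2 x)%:E) by exact/measurable_EFinP.
have mar : measurable_fun setT (fun x => a%:E * (r2 x)%:E) by exact: emeasurable_funM.
have -> : 1 + a%:E * \int[mu]_x (r2 x)%:E = \int[mu]_x (1 + a%:E * (r2 x)%:E).
  rewrite ge0_integralD//; last by move=> x _; rewrite mule_ge0// lee_fin ?dotvv_ge0.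
  have -> : \int[mu]_(x in setT) (1 : \bar R) = 1.
    by rewrite integral_cst// mul1e; exact: probability_setT.
  rewrite ge0_integralZl//.
  by move=> x _; rewrite lee_fin dotvv_ge0.
have ar0 x : 0 <= 1 + a%:E * (r2 x)%:E.
  by rewrite adde_ge0// mule_ge0// lee_fin dotvv_ge0.
have m1ar : measurable_fun setT (fun x => 1 + a%:E * (r2 x)%:E) by exact: emeasurable_funD.
rewrite (ge0_integral_target wcf c0 muE)//.
pose q (x : 'rV[R]_d) := (c * expR (- f x))%R.
have mq : measurable_fun setT (fun x => (q x)%:E) by exact/measurable_EFinP.
have mqs : measurable_fun setT (fun x : 'rV[R]_d => (q (s *: x + (1 - s) *: x0)%R)%:E).
  exact: (measurableT_comp mq (measurable_affine_rV _ _)).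
have q1 : \int[leb d]_x (q x)%:E = 1 by rewrite -muE// probability_setT.
have -> : (s^-1 ^+ d + B)%:E =
    \int[leb d]_x ((q (s *: x + (1 - s) *: x0)%R)%:E + B%:E * (q x)%:E).
  rewrite ge0_integralD//; last 3 first.
  - by move=> x _; rewrite lee_fin ef_ge0.
  - by move=> x _; rewrite mule_ge0// lee_fin ef_ge0.
  - exact: emeasurable_funM.
  rewrite ge0_integralZl//; last by move=> x _; rewrite lee_fin ef_ge0.
  rewrite (integral_leb_affine s0 _ (g := fun x => (q x)%:E))//.
  by rewrite q1 !mule1 EFinD.
apply: ge0_le_integral => //.
- by move=> x _; rewrite mule_ge0// lee_fin ef_ge0.
- exact: emeasurable_funM.
- by apply: emeasurable_funD => //; exact: emeasurable_funM.
move=> x _; rewrite -!EFinM -!EFinD lee_fin.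
have s01 : (0 <= s <= 1)%R by rewrite (ltW s0) (ltW s1).
have := ler_wpM2l (ltW c0) (density_le x s01).
rewrite -/a -/B /q -/(r2 x).
move: (expR _) (expR _) => e1 e2; lra.
Qed.

(** As [s] tends to 1, [dilation_bound] divided by [1 - s] would give
    [(2 d + |grad f x0|^2 / m2) / m2]. A fixed [s] close to 1 avoids the limit; the constant 3 pays
    for it. *)
Lemma target_second_moment :
  \int[mu]_x (dotv (x - x0) (x - x0))%:E <= (3 * hmc_scale f m2 x0 / m2)%:E.
Proof.
(* This keeps [u * d <= 1/20], hence [(1 + u) ^+ d <= 20/19]; [d.+1] covers dimension 0. *)
pose u : R := ((20 * d.+1%:R)^-1)%R.
have dd : (0 < (d.+1%:R : R))%R by rewrite ltr0n.
have u0 : (0 < u)%R by rewrite invr_gt0 mulr_gt0.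
have ud1 : (u * d.+1%:R = 20^-1)%R by rewrite /u; field; exact: lt0r_neq0.
have ud : (u * d%:R <= 20^-1)%R.
  by rewrite -ud1 ler_wpM2l ?(ltW u0)// ler_nat.
have ud0 : (0 <= u * d%:R)%R by rewrite mulr_ge0// ltW.
have u1 : (u <= 20^-1)%R.
  by rewrite -ud1 -[leLHS]mulr1 ler_wpM2l ?(ltW u0)// ler1n.
pose s : R := ((1 + u)^-1)%R.
have u10 : (0 < 1 + u)%R by rewrite addr_gt0.
have su : (s * (1 + u) = 1)%R by rewrite mulVf// lt0r_neq0.
have s1 : (s < 1)%R by rewrite invf_lt1// ltrDl.
have s0 : (0 < s)%R by rewrite invr_gt0.
have s2 : (20 / 21 <= s)%R.
  by rewrite -(ler_pM2r u10) su; lra.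
have := @dilation_bound s; rewrite s1 andbT => /(_ _)/wrap[]; first by lra.
have -> : (s^-1 = 1 + u)%R by rewrite invrK.
set I := \int[mu]_x _.
have I0 : 0 <= I by apply: integral_ge0 => x _; rewrite lee_fin dotvv_ge0.
have k0 : (0 < (1 - s) * (m2 * (s - 2^-1)))%R.
  by rewrite !mulr_gt0 ?subr_gt0//; lra.
rewrite /hmc_scale sqr_l2norm; move: (dotv (grad f x0) (grad f x0)) (dotvv_ge0 (grad f x0)) => G G0.
have dn0 : (0 <= (d%:R : R))%R by [].
(* The two factors are at most [expR (d u)] and [expR (- d u)]. *)
have bern : ((1 + u) ^+ d * (1 - u * d%:R) <= 1)%R.
  have h1 : ((1 + u) ^+ d <= expR (d%:R * u))%R.
    by rewrite expRM_natl lerXn2r ?nnegrE ?expR_ge0 ?(ltW u10)// expR_ge1Dx.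
  have h2 : (1 - u * d%:R <= expR (- (d%:R * u)))%R.
    by rewrite (mulrC u); exact: expR_ge1Dx.
  rewrite -[leRHS](expRxMexpNx_1 (d%:R * u)%R) ler_pM// ?exprn_ge0 ?(ltW u10)//.
  by lra.
(* Finiteness of the moment is a consequence: the value [+oo], with its positive coefficient, would
   contradict [dilation_bound]. *)
case: I I0 => [I| |] I0 //; last first.
  by rewrite gt0_muley ?lte_fin// addey.
rewrite -EFinM -EFinD !lee_fin; rewrite lee_fin in I0.
move: ((1 + u) ^+ d)%R bern => U bern H.
have smu : (1 - s = u * s)%R by rewrite -{1}su; ring.
rewrite smu in H.
have U1 : (U - 1 <= 20 / 19 * (u * d%:R))%R.
  have : (U * (1 - 20^-1) <= U * (1 - u * d%:R) \/ U <= 0)%R.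
    by have [U0|U0] := leP U 0%R; [right|left; rewrite ler_pM2l//; lra].
  case=> [h|h]; last by lra.
  have : (U <= 20 / 19)%R by lra.
  move=> h'; have : (U * (u * d%:R) <= 20 / 19 * (u * d%:R))%R by rewrite ler_wpM2r.
  by lra.
have H1 : (u * (s * (m2 * (s - 2^-1)) * I) <=
    u * (20 / 19 * d%:R + s * (G / (2 * m2))))%R by lra.
rewrite ler_pM2l// in H1.
have Gm : (0 <= G / m2)%R by rewrite divr_ge0// ltW.
have G2 : (G / (2 * m2) = 2^-1 * (G / m2))%R by field; exact: lt0r_neq0.
rewrite G2 in H1; move: (G / m2)%R Gm H1 => {G2}g g0 H1.
have H2 : (s * (2^-1 * g) <= 2^-1 * g)%R.
  by apply: ler_piMl; [rewrite mulr_ge0|exact: ltW].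
have ss : (38 / 100 <= s * (s - 2^-1))%R.
  by have := mulr_ge0 (ltW s0) (_ : 0 <= s - 20 / 21)%R; rewrite subr_ge0 => /(_ s2); lra.
have mI : (0 <= m2 * I)%R by rewrite mulr_ge0// ltW.
have H3 : (38 / 100 * (m2 * I) <= s * (s - 2^-1) * (m2 * I))%R by rewrite ler_wpM2r.
rewrite ler_pdivlMr//.
by lra.
Qed.

End second_moment.

(** * The coupling *)

Section step_size.
Context {R : realType} {d : nat}.
Variables (f : 'rV[R]_d -> R) (m2 M2 h : R).
Hypothesis wcf : well_conditioned f m2 M2.
Hypotheses (h0 : 0 < h) (hle : h <= m2 `^ (4^-1) / (2 * M2 `^ (3 / 4))).

Lemma step_size_le : M2 * h ^+ 2 <= 4^-1.
Proof.
have m0 := wc_m2_gt0 wcf; have M0 := wc_M2_gt0 wcf.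
pose q := M2 `^ (4^-1); have q0 : 0 < q by exact: powR_gt0.
have q4 : q ^+ 4 = M2.
  by rewrite -powR_mulrn ?powR_ge0// -powRrM mulVf// powRr1// ltW.
have q3 : M2 `^ (3 / 4) = q ^+ 3.
  by rewrite -powR_mulrn ?powR_ge0// -powRrM mulrC.
have mq : m2 `^ (4^-1) <= q.
  by apply: ge0_ler_powR; rewrite ?nnegrE ?invr_ge0 ?(ltW m0) ?(ltW M0)// (wc_m2M2 wcf).
have hq : h * (2 * q ^+ 2) <= 1.
  rewrite -(ler_pM2r q0) mul1r; apply: le_trans mq.
  move: hle; rewrite q3 ler_pdivlMr ?mulr_gt0 ?exprn_gt0//.
  by rewrite (_ : h * (2 * q ^+ 3) = h * (2 * q ^+ 2) * q); last by ring.
rewrite -q4; have : (h * (2 * q ^+ 2)) ^+ 2 <= 1.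
  by rewrite exprn_ile1// !mulr_ge0// ?exprn_ge0// ltW.
rewrite (_ : (h * (2 * q ^+ 2)) ^+ 2 = 4 * (q ^+ 4 * h ^+ 2)); last by ring.
by lra.
Qed.

Lemma theta_gt0 : 0 < hmc_theta m2 h.
Proof. by rewrite /hmc_theta divr_gt0// mulr_gt0 ?exprn_gt0// (wc_m2_gt0 wcf). Qed.

Lemma theta_le1 : hmc_theta m2 h <= 1.
Proof.
rewrite /hmc_theta; have : m2 * h ^+ 2 <= M2 * h ^+ 2.
  by rewrite ler_wpM2r ?sqr_ge0// (wc_m2M2 wcf).
by have := step_size_le; lra.
Qed.

Lemma hmc_iters_ge (x0 : 'rV[R]_d) (eps : R) :
  (hmc_theta m2 h)^-1 * ln (4 / eps ^+ 2 * hmc_scale f m2 x0) <=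
  (hmc_iters f m2 x0 eps h)%:R.
Proof.
rewrite /hmc_iters natr_absz ger0_norm ?le_max ?lexx//.
apply: (le_trans (ceil_ge _)).
by rewrite ler_int le_max lexx orbT.
Qed.

(** Rounding up adds at most 1; [0 <= B] handles a nonpositive logarithm. *)
Lemma hmc_iters_le (x0 : 'rV[R]_d) (eps B : R) : 0 <= B ->
  (hmc_theta m2 h)^-1 * ln (4 / eps ^+ 2 * hmc_scale f m2 x0) + 1 <= B ->
  (hmc_iters f m2 x0 eps h)%:R <= B.
Proof.
move=> B0 HB; rewrite /hmc_iters natr_absz ger0_norm ?le_max ?lexx//.
set r := _ * _ in HB *; have [c0|c0] := leP (Num.ceil r) 0; first by [].
apply: le_trans HB; have /andP[+ _] := ceil_itv r.
by rewrite intrB => /ltW; rewrite lerBlDr.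
Qed.

Lemma hmc_scale_ge0 (x0 : 'rV[R]_d) : 0 <= hmc_scale f m2 x0.
Proof. by rewrite addr_ge0// divr_ge0 ?sqr_ge0// ltW// (wc_m2_gt0 wcf). Qed.

(** [(1 - theta)^N <= expR (- theta N)], and [N] is at least the logarithm divided by [theta]. A
    null scale is set apart, the logarithm being meaningful only for a positive argument. *)
Lemma contraction_power_le (x0 : 'rV[R]_d) (eps : R) : 0 < eps ->
  (1 - hmc_theta m2 h) ^+ hmc_iters f m2 x0 eps h * (4 * hmc_scale f m2 x0) <=
  eps ^+ 2.
Proof.
move=> e0; have e20 : 0 < eps ^+ 2 by rewrite exprn_gt0.
have := hmc_scale_ge0 x0; rewrite le_eqVlt => /predU1P[<-|A0].
  by rewrite !mulr0 ltW.
have t0 := theta_gt0; set N := hmc_iters _ _ _ _ _; set A := hmc_scale f m2 x0 in A0 *.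
set t := hmc_theta m2 h in t0 *.
have L0 : 0 < 4 / eps ^+ 2 * A by rewrite mulr_gt0// divr_gt0.
have H1 : (1 - t) ^+ N <= expR (- (t * N%:R)).
  rewrite (_ : - (t * N%:R) = N%:R * - t); last by ring.
  rewrite expRM_natl lerXn2r ?nnegrE ?expR_ge0 ?subr_ge0 ?theta_le1//.
  exact: expR_ge1Dx.
have H2 : expR (- (t * N%:R)) <= (4 / eps ^+ 2 * A)^-1.
  rewrite -[X in X^-1]lnK ?posrE// -expRN ler_expR lerN2.
  have ti : 0 < t^-1 by rewrite invr_gt0.
  by rewrite -(ler_pM2l ti) mulKf ?lt0r_neq0//; exact: hmc_iters_ge.
have H3 := le_trans H1 H2.
have A40 : 0 <= 4 * A by rewrite mulr_ge0// ltW.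
apply: (le_trans (ler_wpM2r A40 H3)).
rewrite (_ : (4 / eps ^+ 2 * A)^-1 * (4 * A) = eps ^+ 2)//.
by field; rewrite !lt0r_neq0.
Qed.

End step_size.

(** * The ideal chain and its law *)

Section ideal_chain.
Context {R : realType} {d : nat}.
Variables (f : 'rV[R]_d -> R) (m2 M2 h : R).
Hypothesis wcf : well_conditioned f m2 M2.
Hypotheses (h0 : 0 < h) (Mh : M2 * h ^+ 2 <= 4^-1).
Context (dO : measure_display) (Omega : measurableType dO).
Variables (P : probability Omega R) (V X : nat -> {RV P >-> 'rV[R]_d}).

(** The start [y] is a parameter: at fixed [y] the chain depends on the velocities alone. The random
    start lives on another space and enters through a product. *)
Fixpoint ideal_chain (k : nat) (y : 'rV[R]_d) (w : Omega) : 'rV[R]_d :=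
  if k is k'.+1 then (flow_map f h (ideal_chain k' y w, V k' w)).1 else y.

Lemma history_sub k : history V X k `<=` history V X k.+1.
Proof.
apply: sub_sigma_algebra2 => A [[j jk HA]|[j jk HA]].
  by left; exists j => //=; rewrite leqW.
by right; exists j => //=; rewrite ltnW.
Qed.

(** Makes the fresh velocity [V k] independent of the ideal chain at step [k]. *)
Lemma ideal_chain_history k y A : measurable A ->
  history V X k (ideal_chain k y @^-1` A).
Proof.
elim: k A => [|k IH] A mA.
  have -> : ideal_chain 0 y @^-1` A = if `[< A y >] then setT else set0.
    by case: asboolP => Ay; apply/seteqP; split.
  case: ifPn => _; last exact: sigma_algebra0.
  by rewrite -setC0; apply: sigma_algebraC; exact: sigma_algebra0.
pose G := \bigcup_(j in [set j | (j <= k.+1)%N])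
        preimage_set_system setT (X j) measurable `|`
      \bigcup_(j in [set j | (j < k.+1)%N])
        preimage_set_system setT (V j) measurable.
(* The sample space with the history as its sigma-algebra, so that the composition of measurable
   maps applies. *)
pose T := g_sigma_algebraType G.
have m1 : measurable_fun setT (ideal_chain k y : T -> 'rV[R]_d).
  by move=> _ B mB; rewrite setTI; apply: history_sub; exact: IH.
have mV : measurable_fun setT (V k : T -> 'rV[R]_d).
  move=> _ B mB; apply: sub_sigma_algebra; right; exists k => //=.
  by exists B.
have mp : measurable_fun setT (fun w : T => (ideal_chain k y w, V k w)).
  exact: measurable_fun_pair.
have := measurableT_comp (measurable_flow_map1 wcf h0 Mh) mp.
by move=> /(_ measurableT A mA); rewrite setTI.
Qed.

Context (dO' : measure_display) (Omega' : measurableType dO').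
Variables (Q : probability Omega' R) (Y : {RV Q >-> 'rV[R]_d}).

Definition ideal_pair (k : nat) (p : Omega * Omega') : 'rV[R]_d :=
  ideal_chain k (Y p.2) p.1.

Lemma measurable_ideal_pair k : measurable_fun setT (ideal_pair k).
Proof.
elim: k => [|k IH]; first exact: (measurableT_comp (measurable_funPT Y) measurable_snd).
have mV : measurable_fun setT (fun p : Omega * Omega' => V k p.1).
  exact: (measurableT_comp (measurable_funPT (V k)) measurable_fst).
exact: (measurableT_comp (measurable_flow_map1 wcf h0 Mh) (measurable_fun_pair IH mV)).
Qed.

Local Open Scope ereal_scope.

(** Slicing at a fixed start is the form in which the independence hypothesis can be used. *)
Let product_ysection (W : set (Omega * Omega')) : measurable W ->
  (P \x Q) W = \int[Q]_y P (ysection W y).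
Proof.
move=> mW; rewrite (@product_measure_unique _ _ _ _ _ P Q (P \x^ Q))// => A B mA mB.
exact: product_measure2E.
Qed.

Variable N : nat.
Hypothesis V_gauss : forall k, (k < N)%N ->
  forall B, measurable B -> distribution P (V k) B = gauss_rV R d B.
Hypothesis V_indep : forall k, (k < N)%N -> forall A B, history V X k A ->
  measurable B -> P (A `&` V k @^-1` B) = P A * P (V k @^-1` B).
Hypothesis Y_density : density_prop_exp f (distribution Q Y).

(** By induction, position and fresh velocity have the product of target and Gaussian as joint law,
    by uniqueness on rectangles; then [flow_map_invariant] applies. *)
Lemma ideal_pair_law k A : (k <= N)%N -> measurable A ->
  (P \x Q) (ideal_pair k @^-1` A) = distribution Q Y A.
Proof.
elim: k A => [|k IH] A kN mA.
  have -> : ideal_pair 0 @^-1` A = setT `*` (Y @^-1` A).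
    by apply/seteqP; split=> p //= [].
  rewrite product_measure1E//; last by rewrite -[X in measurable X]setTI; exact: measurable_funP.
  by rewrite [X in X * _]probability_setT mul1e.
have mYk := measurable_ideal_pair k.
have mV : measurable_fun setT (fun p : Omega * Omega' => V k p.1).
  exact: (measurableT_comp (measurable_funPT (V k)) measurable_fst).
have mp : measurable_fun setT (fun p => (ideal_pair k p, V k p.1)).
  exact: measurable_fun_pair.
have [c c0 muE] := Y_density.
rewrite -(flow_map_invariant wcf h0 Mh c0 muE (V_gauss kN) mA).
pose ms := isMeasurableFun.Build _ _ _ _ _ mp.
pose phi : {mfun (Omega * Omega')%type >-> ('rV[R]_d * 'rV[R]_d)%type} :=
  HB.pack (fun p => (ideal_pair k p, V k p.1)) ms.
have mF : measurable [set z : 'rV[R]_d * 'rV[R]_d | A (flow_map f h z).1].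
  by rewrite -[X in measurable X]setTI; exact: (measurable_flow_map1 wcf h0 Mh measurableT mA).
apply/esym.
rewrite (@product_measure_unique _ _ _ _ _ (distribution Q Y) (distribution P (V k))
  (distribution (P \x Q) phi))// => B C mB mC.
rewrite /distribution /pushforward.
have mYB : measurable (ideal_pair k @^-1` B).
  by rewrite -[X in measurable X]setTI; exact: mYk.
transitivity ((P \x Q) (ideal_pair k @^-1` B `&` (fun p => V k p.1) @^-1` C)).
  by [].
rewrite product_ysection; last first.
  by apply: measurableI => //; rewrite -[X in measurable X]setTI; exact: mV.
rewrite -[X in _ = X * _]/(distribution Q Y B) -(IH B (ltnW kN) mB) product_ysection//.
have mP : measurable_fun setT (fun y => P (ysection (ideal_pair k @^-1` B) y)).
  exact: measurable_fun_ysection.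
rewrite -ge0_integralZr//.
apply: eq_integral => y _.
rewrite (_ : ysection _ y = ideal_chain k (Y y) @^-1` B `&` V k @^-1` C); last first.
  by apply/seteqP; split=> w; rewrite /ysection/= inE.
rewrite (V_indep kN)//; last exact: ideal_chain_history.
congr (P _ * _); apply/seteqP; split=> w; by rewrite /ysection/= inE.
Qed.

End ideal_chain.

(** * The distance between the run and the ideal chain *)

Section coupling_bound.
Context {R : realType} {d : nat}.
Variables (f : 'rV[R]_d -> R) (m2 M2 eps h : R) (x0 : 'rV[R]_d).
Hypothesis wcf : well_conditioned f m2 M2.
Hypotheses (e0 : 0 < eps) (h0 : 0 < h).
Hypothesis hle : h <= m2 `^ (4^-1) / (2 * M2 `^ (3 / 4)).
Context (dO : measure_display) (Omega : measurableType dO).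
Variables (P : probability Omega R) (V X : nat -> {RV P >-> 'rV[R]_d}).
Hypothesis run : hmc_run x0 f m2 eps h V X.

Let N := hmc_iters f m2 x0 eps h.

Let Mh : M2 * h ^+ 2 <= 4^-1. Proof. exact: step_size_le wcf h0 hle. Qed.

(** Through the exact endpoint [x h], the distance obeys [D' <= theta b + (1 - theta) D] with
    [b = eps / (2 * Num.sqrt m2)], because [hmc_tol] is [theta b]. *)
Lemma run_ideal_dist k y w : (k <= N)%N ->
  l2norm (X k w - ideal_chain f h V k y w) <=
  (1 - hmc_theta m2 h) ^+ k * l2norm (x0 - y) +
  (1 - (1 - hmc_theta m2 h) ^+ k) * (eps / (2 * Num.sqrt m2)).
Proof.
elim: k => [|k IH] kN.
  by rewrite (hmc_start run) expr0 mul1r subrr mul0r addr0.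
have [x xs xtol] := hmc_step run kN w.
have [y' [v' [yv y'0 v'0 yE]]] := flow_mapP wcf h0 Mh (ideal_chain f h V k y w, V k w).
have /= := flow_contraction wcf h0 Mh (hamiltonian_flow_on h xs) yv.
case: xs => -> -> _ _; rewrite v'0 y'0 /= => /(_ erefl) H.
rewrite yE /=.
apply: (le_trans (ler_l2norm_dist (x h) _ _)).
apply: (le_trans (lerD xtol H)).
have t1 : 0 <= 1 - hmc_theta m2 h by rewrite subr_ge0 (theta_le1 wcf h0 hle).
apply: (le_trans (lerD (lexx _) (ler_wpM2l t1 (IH (ltnW kN))))).
rewrite /hmc_tol exprS -mulrA.
move: (eps / _) (hmc_theta m2 h) (l2norm _) ((1 - hmc_theta m2 h) ^+ k) => a t b c; lra.
Qed.

Context (dO' : measure_display) (Omega' : measurableType dO').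
Variables (Q : probability Omega' R) (Y : {RV Q >-> 'rV[R]_d}).
Hypothesis Y_density : density_prop_exp f (distribution Q Y).

Let lam := (1 - hmc_theta m2 h) ^+ N.

Let lam01 : 0 <= lam <= 1.
Proof.
have t1 : 0 <= 1 - hmc_theta m2 h by rewrite subr_ge0 (theta_le1 wcf h0 hle).
have t2 : 1 - hmc_theta m2 h <= 1 by rewrite gerBl ltW// (theta_gt0 wcf h0).
by rewrite exprn_ge0// exprn_ile1.
Qed.

Let cost_le p : l2norm (X N p.1 - ideal_pair f h V Y N p) ^+ 2 <=
  lam * dotv (Y p.2 - x0) (Y p.2 - x0) + (1 - lam) * (eps ^+ 2 / (4 * m2)).
Proof.
have m0 := wc_m2_gt0 wcf; have /andP[l0 l1] := lam01.
have H := run_ideal_dist (Y p.2) p.1 (leqnn N); rewrite -/lam in H.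
have a0 := l2norm_ge0 (X N p.1 - ideal_chain f h V N (Y p.2) p.1).
have -> : eps ^+ 2 / (4 * m2) = (eps / (2 * Num.sqrt m2)) ^+ 2.
  by rewrite expr_div_n exprMn sqr_sqrtr ?(ltW m0)//; congr (_ / (_ * _)); ring.
rewrite -sqr_l2norm (l2normBC (Y p.2)) /ideal_pair; move: H a0.
move: (l2norm (X N p.1 - _)) (l2norm (x0 - _)) (eps / _) => a b c H a0.
have : a ^+ 2 <= (lam * b + (1 - lam) * c) ^+ 2.
  by rewrite ler_sqr ?nnegrE// (le_trans a0 H).
(* The defect in the convexity of the square. *)
have : 0 <= lam * (1 - lam) * (b - c) ^+ 2.
  by apply: mulr_ge0; [rewrite mulr_ge0// subr_ge0|exact: sqr_ge0].
by lra.
Qed.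

Local Open Scope ereal_scope.

Lemma W2_run_le : W2 (distribution P (X N)) (distribution Q Y) <=
  (eps / Num.sqrt m2)%:E.
Proof.
have m0 := wc_m2_gt0 wcf; have /andP[l0 l1] := lam01.
have es0 : (0 <= eps / Num.sqrt m2)%R by rewrite divr_ge0 ?sqrtr_ge0// ltW.
have mYN := measurable_ideal_pair wcf h0 Mh V Y N.
have mXN : measurable_fun setT (fun p : Omega * Omega' => X N p.1).
  exact: (measurableT_comp (measurable_funPT (X N)) measurable_fst).
have mp : measurable_fun setT (fun p => (X N p.1, ideal_pair f h V Y N p)).
  exact: measurable_fun_pair.
pose ms := isMeasurableFun.Build _ _ _ _ _ mp.
pose phi : {mfun (Omega * Omega')%type >-> ('rV[R]_d * 'rV[R]_d)%type} :=
  HB.pack (fun p => (X N p.1, ideal_pair f h V Y N p)) ms.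
rewrite /W2 -(gee0_abs (x := (eps / Num.sqrt m2)%:E)) ?lee_fin// -sqrte_sqr.
rewrite lee_sqrt ?sqre_ge0//.
apply: ge_ereal_inf; eexists.
  (* The coupling: joint law of the run and the ideal chain after [N] steps. *)
  exists (distribution (P \x Q) phi); last by reflexivity.
  move=> A mA; split.
    rewrite /distribution /pushforward/=.
    rewrite [X in (P \x Q) X](_ : _ = (X N @^-1` A) `*` setT); last first.
      by apply/seteqP; split=> p //= [].
    rewrite product_measure1E//; last by rewrite -[X in measurable X]setTI; exact: measurable_funP.
    by rewrite [X in _ * X]probability_setT mule1.
  rewrite /distribution /pushforward/=.
  exact: (ideal_pair_law wcf h0 Mh (hmc_gauss run) (hmc_indep run) Y_density (leqnn N) mA).
have mcost : measurable_fun setT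
    (fun z : 'rV[R]_d * 'rV[R]_d => (l2norm (z.1 - z.2) ^+ 2)%:E).
  apply/measurable_EFinP; under eq_fun do rewrite sqr_l2norm.
  by apply: measurable_fun_dotv; apply: measurable_fun_rVB;
    [exact: measurable_fst|exact: measurable_snd|exact: measurable_fst|exact: measurable_snd].
rewrite ge0_integral_distribution//; last by move=> z; rewrite lee_fin sqr_ge0.
pose b2 : R := (eps ^+ 2 / (4 * m2))%R.
have b20 : (0 <= b2)%R by rewrite divr_ge0 ?sqr_ge0// mulr_ge0// ltW.
pose r2 (x : 'rV[R]_d) : \bar R := (dotv (x - x0) (x - x0))%:E.
have r20 x : 0 <= r2 x by rewrite lee_fin dotvv_ge0.
have mr2 : measurable_fun setT r2.
  apply/measurable_EFinP.
  have mB : measurable_fun setT (fun x : 'rV[R]_d => x - x0)%R.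
    by apply: measurable_fun_rVB; [exact: measurable_id|exact: measurable_cst].
  exact: measurable_fun_dotv.
have mr2Y : measurable_fun setT (r2 \o Y).
  exact: (measurableT_comp mr2 (measurable_funPT Y)).
pose B (p : Omega * Omega') : \bar R := lam%:E * r2 (Y p.2) + ((1 - lam) * b2)%:E.
have B0 p : 0 <= B p.
  by rewrite adde_ge0 ?mule_ge0// lee_fin// mulr_ge0// subr_ge0.
have mB : measurable_fun setT B.
  apply: emeasurable_funD => //; apply: emeasurable_funM => //.
  exact: (measurableT_comp mr2Y measurable_snd).
apply: (@le_trans _ _ (\int[P \x Q]_p B p)).
  apply: ge0_le_integral => //.
  - by move=> p _; rewrite lee_fin sqr_ge0.
  - exact: (measurableT_comp mcost mp).
  - by move=> p _; rewrite /B /r2 -EFinM -EFinD lee_fin; exact: cost_le.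
rewrite (fubini_tonelli2 B)//.
have -> : \int[Q]_y fubini_G P B y = lam%:E * \int[distribution Q Y]_x r2 x + ((1 - lam) * b2)%:E.
  rewrite ge0_integral_distribution// -ge0_integralZl//; last by move=> y _; exact: r20.
  transitivity (\int[Q]_y (lam%:E * (r2 \o Y) y + ((1 - lam) * b2)%:E)).
    apply: eq_integral => y _; rewrite /fubini_G /B/= integral_cst//.
    by rewrite [X in _ * X]probability_setT mule1.
  rewrite ge0_integralD//; last 3 first.
  - by move=> y _; rewrite mule_ge0// r20.
  - exact: emeasurable_funM.
  - by move=> y _; rewrite lee_fin mulr_ge0// subr_ge0.
  by rewrite integral_cst// [X in _ + _ * X]probability_setT mule1.
have [c c0 muE] := Y_density.
have := target_second_moment wcf x0 c0 muE; rewrite -/r2 => HM.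
apply: (@le_trans _ _ (lam%:E * (3 * hmc_scale f m2 x0 / m2)%:E + ((1 - lam) * b2)%:E)).
  by rewrite leeD2r// lee_wpmul2l ?lee_fin.
rewrite -EFinM -EFinD -EFin_expe lee_fin expr_div_n sqr_sqrtr ?(ltW m0)//.
(* This bounds the first term by [3/4] of [eps ^+ 2]; the tolerances add at most [1/4]. *)
have := contraction_power_le wcf h0 hle x0 e0; rewrite -/N -/lam => HL.
rewrite /b2 ler_pdivlMr//.
have -> : ((lam * (3 * hmc_scale f m2 x0 / m2) + (1 - lam) * (eps ^+ 2 / (4 * m2))) * m2 =
  3 * (lam * hmc_scale f m2 x0) + (1 - lam) * (eps ^+ 2 / 4))%R.
  by field; exact: lt0r_neq0.
have : (0 <= lam * (eps ^+ 2))%R by rewrite mulr_ge0// sqr_ge0.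
by move: HL; lra.
Qed.

End coupling_bound.

(** [1 < K] keeps the logarithm above [ln K > 0], so the additive terms [8 * ln 4] and the rounding
    1 are absorbed in the constant. *)
Lemma hmc_iters_bound (R : realType) (K : R) : 1 < K ->
  exists2 C : R, 0 < C &
  forall (d : nat) (f : 'rV[R]_d -> R) (m2 M2 eps h : R) (x0 : 'rV[R]_d),
    well_conditioned f m2 M2 -> 0 < eps ->
    0 < h -> h <= m2 `^ (4^-1) / (2 * M2 `^ (3 / 4)) ->
    K <= hmc_scale f m2 x0 / eps ->
    (hmc_iters f m2 x0 eps h)%:R <=
      C / (m2 * h ^+ 2) * ln (hmc_scale f m2 x0 / eps).
Proof.
move=> K1; have lnK0 : 0 < ln K by rewrite ln_gt0.
have ln40 : 0 <= ln (4 : R) by rewrite ln_ge0// ler1n.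
exists (16 + (8 * ln 4 + 1) / ln K).
  by rewrite addr_gt0// divr_gt0// ltr_wpDl// mulr_ge0.
move=> d f m2 M2 eps h x0 wcf e0 h0 hle KA.
have m0 := wc_m2_gt0 wcf.
(* Used to bound [A / eps ^+ 2] by [(A / eps) ^+ 2]. In dimension 0 the scale is 0, against
   [1 < K]. *)
have A1 : 1 <= hmc_scale f m2 x0.
  case: d f x0 wcf KA => [|d] f x0 wcf KA.
    exfalso; move: KA; rewrite /hmc_scale (_ : grad f x0 = 0); last by apply/rowP => -[].
    by rewrite l2norm0 expr0n/= mul0r addr0 mul0r; lra.
  rewrite /hmc_scale -[leLHS]add0r lerD ?ler1n//.
  by rewrite divr_ge0 ?sqr_ge0// ltW.
set A := hmc_scale f m2 x0 in A1 KA *.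
have A0 : 0 < A by apply: lt_le_trans A1.
have Ae0 : 0 < A / eps by rewrite divr_gt0.
have lK : ln K <= ln (A / eps).
  by rewrite ler_ln ?posrE// (lt_trans ltr01).
set l := ln (A / eps) in lK *; set z := m2 * h ^+ 2.
have z0 : 0 < z by rewrite mulr_gt0 ?exprn_gt0.
have z1 : z <= 1.
  have : m2 * h ^+ 2 <= M2 * h ^+ 2 by rewrite ler_wpM2r ?sqr_ge0// (wc_m2M2 wcf).
  by have := step_size_le wcf h0 hle; rewrite /z; lra.
have l0 : 0 < l by apply: lt_le_trans lK.
have C0 : 0 <= (8 * ln 4 + 1) / ln K.
  by rewrite divr_ge0 ?(ltW lnK0)// addr_ge0// mulr_ge0.
have HB : (8 * ln 4 + 1) + 16 * l <= (16 + (8 * ln 4 + 1) / ln K) * l.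
  have : (8 * ln 4 + 1) / ln K * ln K <= (8 * ln 4 + 1) / ln K * l by rewrite ler_wpM2l.
  by rewrite divfK ?lt0r_neq0//; lra.
apply: hmc_iters_le.
  by rewrite mulr_ge0 ?(ltW l0)// divr_ge0 ?(ltW z0)// addr_ge0.
rewrite -/A.
have lnle : ln (4 / eps ^+ 2 * A) <= ln 4 + 2 * l.
  have -> : ln 4 + 2 * l = ln (4 * (A / eps) ^+ 2).
    rewrite lnM ?posrE ?exprn_gt0//; congr +%R.
    by rewrite expr2 lnM ?posrE// -/l; ring.
  have p1 : 0 < 4 / eps ^+ 2 * A by rewrite mulr_gt0// divr_gt0// exprn_gt0.
  have p2 : 0 < 4 * (A / eps) ^+ 2 by rewrite mulr_gt0// exprn_gt0.
  rewrite ler_ln ?posrE//.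
  rewrite expr_div_n mulrAC mulrA ler_pM2r ?invr_gt0 ?exprn_gt0//.
  by rewrite ler_pM2l// expr2 ler_peMl// ltW.
rewrite /hmc_theta -/z invf_div.
(* Lets the rounding 1 be multiplied by [1 / (m2 h^2)]. *)
have y1 : 1 <= z^-1 by rewrite invf_ge1.
have y0 : 0 <= z^-1 by rewrite invr_ge0 ltW.
have a1 := ler_wpM2l y0 lnle; have a2 := ler_wpM2l y0 HB.
move: (z^-1) (ln (4 / _ * _)) (ln 4) (_ / ln K) y1 a1 a2 => y L l4 k y1 a1 a2.
by lra.
Qed.

Theorem mainTheorem3 (R : realType) :
  (forall (d : nat) (f : 'rV[R]_d -> R) (m2 M2 eps h : R) (x0 : 'rV[R]_d),
     well_conditioned f m2 M2 ->
     0 < eps ->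
     0 < h -> h <= m2 `^ (4^-1) / (2 * M2 `^ (3 / 4)) ->
     forall (dO : measure_display) (Omega : measurableType dO)
            (P : probability Omega R) (V X : nat -> {RV P >-> 'rV[R]_d}),
     hmc_run x0 f m2 eps h V X ->
     forall (dO' : measure_display) (Omega' : measurableType dO')
            (Q : probability Omega' R) (Y : {RV Q >-> 'rV[R]_d}),
     density_prop_exp f (distribution Q Y) ->
     (W2 (distribution P (X (hmc_iters f m2 x0 eps h))) (distribution Q Y)
        <= (eps / Num.sqrt m2)%:E)%E)
  /\
  (forall K : R, 1 < K ->
   exists2 C : R, 0 < C &
   forall (d : nat) (f : 'rV[R]_d -> R) (m2 M2 eps h : R) (x0 : 'rV[R]_d),
     well_conditioned f m2 M2 ->
     0 < eps ->
     0 < h -> h <= m2 `^ (4^-1) / (2 * M2 `^ (3 / 4)) ->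
     K <= (l2norm (grad f x0) ^+ 2 / m2 + d%:R) / eps ->
     (hmc_iters f m2 x0 eps h)%:R <=
       C / (m2 * h ^+ 2) *
       ln ((l2norm (grad f x0) ^+ 2 / m2 + d%:R) / eps)).

Proof.
split=> [d f m2 M2 eps h x0 wcf e0 h0 hle dO Omega P V X run dO' Omega' Q Y Yd|K K1].
  exact: (W2_run_le wcf e0 h0 hle run Yd).
exact: (hmc_iters_bound K1).
Qed.
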